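(* Let $T$ be a given horizon, and let $\mathcal{C}_{\mathrm{SLP}},\mathcal{C}_{\mathrm{M1}},\mathcal{C}_{\mathrm{M2}},\mathcal{C}_{\mathrm{IOP}}$ be the sets of controllers obtained from the four closed-loop parameterizations with FIR parameters of horizon $T$ (defined in the context). If $(A,B,C)$ and $(A_k,B_k,C_k)$ are both stabilizable and detectable, then $$\mathcal{C}_{\mathrm{SLP}}\subseteq\mathcal{C}_{\mathrm{M1}}\subseteq\mathcal{C}_{\mathrm{IOP}}\subseteq\mathcal{C}_{\mathrm{stab}}\quad\text{and}\quad \mathcal{C}_{\mathrm{SLP}}\subseteq\mathcal{C}_{\mathrm{M2}}\subseteq\mathcal{C}_{\mathrm{IOP}}\subseteq\mathcal{C}_{\mathrm{stab}}.$$ If $(A,B,C)$ and $(A_k,B_k,C_k)$ are both controllable and observable, then $$\mathcal{C}_{\mathrm{SLP}}=\mathcal{C}_{\mathrm{M1}}=\mathcal{C}_{\mathrm{M2}}=\mathcal{C}_{\mathrm{IOP}}\subseteq\mathcal{C}_{\mathrm{stab}}.$$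
   Context: Plant (discrete-time LTI, real matrices): $x[t+1]=Ax[t]+Bu[t]+\delta_x[t]$, $y[t]=Cx[t]+\delta_y[t]$, $\mathbf{G}=C(zI-A)^{-1}B$. Controller: $\xi[t+1]=A_k\xi[t]+B_ky[t]$, $u[t]=C_k\xi[t]+D_ky[t]+\delta_u[t]$, $\mathbf{K}=C_k(zI-A_k)^{-1}B_k+D_k$; $(A_k,B_k,C_k)$ refers to the realization used for each controller $\mathbf{K}$ under consideration. $\mathbf{K}$ internally stabilizes $\mathbf{G}$ if $(x[t],\xi[t])\to0$ for all initial states when all disturbances vanish; $\mathcal{C}_{\mathrm{stab}}$ is the set of all internally stabilizing $\mathbf{K}$. $\mathcal{RH}_\infty$ is the set of real-rational proper stable transfer matrices (poles of modulus $<1$); $\mathcal{F}_T=\{\mathbf{H}\in\mathcal{RH}_\infty:\mathbf{H}=\sum_{k=0}^T z^{-k}H_k\}$. Definitions of the sets: $\mathcal{C}_{\mathrm{SLP}}$: all $\mathbf{K}=\boldsymbol{\Phi}_{uy}-\boldsymbol{\Phi}_{ux}\boldsymbol{\Phi}_{xx}^{-1}\boldsymbol{\Phi}_{xy}$ with $\boldsymbol{\Phi}_{xx},\boldsymbol{\Phi}_{ux},\boldsymbol{\Phi}_{xy},\boldsymbol{\Phi}_{uy}\in\mathcal{F}_T$ satisfying $\begin{bmatrix}zI-A&-B\end{bmatrix}\begin{bmatrix}\boldsymbol{\Phi}_{xx}&\boldsymbol{\Phi}_{xy}\\ \boldsymbol{\Phi}_{ux}&\boldsymbol{\Phi}_{uy}\end{bmatrix}=\begin{bmatrix}I&0\end{bmatrix}$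 and $\begin{bmatrix}\boldsymbol{\Phi}_{xx}&\boldsymbol{\Phi}_{xy}\\ \boldsymbol{\Phi}_{ux}&\boldsymbol{\Phi}_{uy}\end{bmatrix}\begin{bmatrix}zI-A\\ -C\end{bmatrix}=\begin{bmatrix}I\\ 0\end{bmatrix}$. $\mathcal{C}_{\mathrm{M1}}$: all $\mathbf{K}=\boldsymbol{\Phi}_{uy}\boldsymbol{\Phi}_{yy}^{-1}$ with $\boldsymbol{\Phi}_{yx},\boldsymbol{\Phi}_{yy},\boldsymbol{\Phi}_{ux},\boldsymbol{\Phi}_{uy}\in\mathcal{F}_T$ satisfying $\begin{bmatrix}I&-\mathbf{G}\end{bmatrix}\begin{bmatrix}\boldsymbol{\Phi}_{yx}&\boldsymbol{\Phi}_{yy}\\ \boldsymbol{\Phi}_{ux}&\boldsymbol{\Phi}_{uy}\end{bmatrix}=\begin{bmatrix}C(zI-A)^{-1}&I\end{bmatrix}$ and $\begin{bmatrix}\boldsymbol{\Phi}_{yx}&\boldsymbol{\Phi}_{yy}\\ \boldsymbol{\Phi}_{ux}&\boldsymbol{\Phi}_{uy}\end{bmatrix}\begin{bmatrix}zI-A\\ -C\end{bmatrix}=0$. $\mathcal{C}_{\mathrm{M2}}$: all $\mathbf{K}=\boldsymbol{\Phi}_{uu}^{-1}\boldsymbol{\Phi}_{uy}$ with $\boldsymbol{\Phi}_{xy},\boldsymbol{\Phi}_{uy},\boldsymbol{\Phi}_{xu},\boldsymbol{\Phi}_{uu}\in\mathcal{F}_T$ satisfying $\begin{bmatrix}zI-A&-B\end{bmatrix}\begin{bmatrix}\boldsymbol{\Phi}_{xy}&\boldsymbol{\Phi}_{xu}\\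 \boldsymbol{\Phi}_{uy}&\boldsymbol{\Phi}_{uu}\end{bmatrix}=0$ and $\begin{bmatrix}\boldsymbol{\Phi}_{xy}&\boldsymbol{\Phi}_{xu}\\ \boldsymbol{\Phi}_{uy}&\boldsymbol{\Phi}_{uu}\end{bmatrix}\begin{bmatrix}-\mathbf{G}\\ I\end{bmatrix}=\begin{bmatrix}(zI-A)^{-1}B\\ I\end{bmatrix}$. $\mathcal{C}_{\mathrm{IOP}}$: all $\mathbf{K}=\boldsymbol{\Phi}_{uy}\boldsymbol{\Phi}_{yy}^{-1}$ with $\boldsymbol{\Phi}_{yy},\boldsymbol{\Phi}_{uy},\boldsymbol{\Phi}_{yu},\boldsymbol{\Phi}_{uu}\in\mathcal{F}_T$ satisfying $\begin{bmatrix}I&-\mathbf{G}\end{bmatrix}\begin{bmatrix}\boldsymbol{\Phi}_{yy}&\boldsymbol{\Phi}_{yu}\\ \boldsymbol{\Phi}_{uy}&\boldsymbol{\Phi}_{uu}\end{bmatrix}=\begin{bmatrix}I&0\end{bmatrix}$ and $\begin{bmatrix}\boldsymbol{\Phi}_{yy}&\boldsymbol{\Phi}_{yu}\\ \boldsymbol{\Phi}_{uy}&\boldsymbol{\Phi}_{uu}\end{bmatrix}\begin{bmatrix}-\mathbf{G}\\ I\end{bmatrix}=\begin{bmatrix}0\\ I\end{bmatrix}$. *)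

(* Defs.v *)
From HB Require Import structures.
From mathcomp Require Import all_boot all_order all_algebra.
From mathcomp Require Import complex.
From mathcomp Require Import all_classical all_reals all_analysis.

Set Implicit Arguments.
Unset Strict Implicit.
Unset Printing Implicit Defensive.

Import Order.TTheory GRing.Theory Num.Theory.
Import numFieldNormedType.Exports.
Local Open Scope classical_set_scope.
Local Open Scope ring_scope.

(* R(z), the field in which the entries of real-rational transfer matrices
   live. *)
Notation ratfun R := {fraction {poly R}}.

Definition zvar (R : realType) : ratfun R := tofrac ('X : {poly R}).

Definition cstmx (R : realType) m n (M : 'M[R]_(m, n)) : 'M[ratfun R]_(m, n) :=
  map_mx (fun c : R => tofrac (c%:P : {poly R})) M.

Definition zIsub (R : realType) n (A : 'M[R]_n) : 'M[ratfun R]_n :=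
  (zvar R)%:M - cstmx A.

Definition transfer (R : realType) n m p (A : 'M[R]_n) (B : 'M[R]_(n, m))
    (C : 'M[R]_(p, n)) (D : 'M[R]_(p, m)) : 'M[ratfun R]_(p, m) :=
  cstmx C *m invmx (zIsub A) *m cstmx B + cstmx D.

Definition plant_tf (R : realType) n m p (A : 'M[R]_n) (B : 'M[R]_(n, m))
    (C : 'M[R]_(p, n)) : 'M[ratfun R]_(p, m) :=
  cstmx C *m invmx (zIsub A) *m cstmx B.

Definition proper_ratfun (R : realType) (f : ratfun R) : Prop :=
  exists a b : {poly R},
    [/\ b != 0, (size a <= size b)%N & f = tofrac a / tofrac b].

Definition proper (R : realType) m n (H : 'M[ratfun R]_(m, n)) : Prop :=
  forall i j, proper_ratfun (H i j).

(* Poles are the complex zeros of the denominator in lowest terms; the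
   fraction field carries no canonical representative. *)
Definition pole (R : realType) (f : ratfun R) (l : R[i]) : Prop :=
  exists a b : {poly R},
    [/\ b != 0, coprimep a b, f = tofrac a / tofrac b
      & root (map_poly (real_complex R) b) l].

Definition RHinf (R : realType) m n (H : 'M[ratfun R]_(m, n)) : Prop :=
  proper H /\ forall i j (l : R[i]), pole (H i j) l -> `|l| < 1.

Definition FIR (R : realType) (T : nat) m n (H : 'M[ratfun R]_(m, n)) : Prop :=
  RHinf H /\
  exists Hk : nat -> 'M[R]_(m, n),
    H = \sum_(0 <= k < T.+1) (zvar R) ^- k *: cstmx (Hk k).

Definition schur_stable (R : realType) n (A : 'M[R]_n) : Prop :=
  forall l : R[i], eigenvalue (map_mx (real_complex R) A) l -> `|l| < 1.

Definition stabilizable (R : realType) n m (A : 'M[R]_n) (B : 'M[R]_(n, m)) :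
    Prop := exists F : 'M[R]_(m, n), schur_stable (A + B *m F).

Definition detectable (R : realType) n p (A : 'M[R]_n) (C : 'M[R]_(p, n)) :
    Prop := exists L : 'M[R]_(n, p), schur_stable (A + L *m C).

Definition controllable (R : realType) n m (A : 'M[R]_n) (B : 'M[R]_(n, m)) :
    Prop := \rank (\mxrow_(i < n) (A ^+ i *m B)) = n.

Definition observable (R : realType) n p (A : 'M[R]_n) (C : 'M[R]_(p, n)) :
    Prop := \rank (\mxcol_(i < n) (C *m A ^+ i)) = n.

(* State-space data of a controller with p inputs (the measurements y) and
   m outputs (the controls u); the state dimension may vary. *)
Record realization (R : realType) (m p : nat) := Realization {
  nk : nat;
  Ak : 'M[R]_nk;
  Bk : 'M[R]_(nk, p);
  Ck : 'M[R]_(m, nk);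
  Dk : 'M[R]_(m, p) }.

Definition realizes (R : realType) m p (r : realization R m p)
    (K : 'M[ratfun R]_(m, p)) : Prop :=
  transfer (Ak r) (Bk r) (Ck r) (Dk r) = K.

(* The realization (A_k, B_k, C_k, D_k) used for each controller K; only
   proper transfer matrices have realizations. *)
Definition realization_choice (R : realType) m p
    (rho : 'M[ratfun R]_(m, p) -> realization R m p) : Prop :=
  forall K, proper K -> realizes (rho K) K.

Definition closed_loop (R : realType) n m p (A : 'M[R]_n) (B : 'M[R]_(n, m))
    (C : 'M[R]_(p, n)) (r : realization R m p)
    (dx : nat -> 'cV[R]_n) (dy : nat -> 'cV[R]_p) (du : nat -> 'cV[R]_m)
    (x : nat -> 'cV[R]_n) (y : nat -> 'cV[R]_p)
    (xi : nat -> 'cV[R]_(nk r)) (u : nat -> 'cV[R]_m) : Prop :=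
  forall t : nat,
    [/\ x t.+1 = A *m x t + B *m u t + dx t,
        y t = C *m x t + dy t,
        xi t.+1 = Ak r *m xi t + Bk r *m y t
      & u t = Ck r *m xi t + Dk r *m y t + du t].

(* Quantifying over all trajectories amounts to quantifying over all initial
   states (x 0, xi 0), since these determine the trajectory. *)
Definition internally_stabilizes (R : realType) n m p (A : 'M[R]_n)
    (B : 'M[R]_(n, m)) (C : 'M[R]_(p, n)) (r : realization R m p) : Prop :=
  forall x y xi u,
    closed_loop A B C (fun=> 0) (fun=> 0) (fun=> 0) x y xi u ->
    (x t @[t --> \oo] --> (0 : 'cV[R]_n)) /\
    (xi t @[t --> \oo] --> (0 : 'cV[R]_(nk r))).

Definition C_stab (R : realType) n m p (A : 'M[R]_n) (B : 'M[R]_(n, m))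
    (C : 'M[R]_(p, n)) (rho : 'M[ratfun R]_(m, p) -> realization R m p) :
    set 'M[ratfun R]_(m, p) :=
  [set K | realizes (rho K) K /\ internally_stabilizes A B C (rho K)].

(* In the four sets below, membership in unitmx records that the inverse
   occurring in the formula for K exists, invmx being total. *)

Definition C_SLP (R : realType) n m p (A : 'M[R]_n) (B : 'M[R]_(n, m))
    (C : 'M[R]_(p, n)) (T : nat) : set 'M[ratfun R]_(m, p) :=
  [set K | exists (Pxx : 'M[ratfun R]_n) (Pxy : 'M[ratfun R]_(n, p))
                  (Pux : 'M[ratfun R]_(m, n)) (Puy : 'M[ratfun R]_(m, p)),
    [/\ [/\ FIR T Pxx, FIR T Pux, FIR T Pxy & FIR T Puy],
        row_mx (zIsub A) (- cstmx B) *m block_mx Pxx Pxy Pux Puy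
          = row_mx 1%:M 0,
        block_mx Pxx Pxy Pux Puy *m col_mx (zIsub A) (- cstmx C)
          = col_mx 1%:M 0,
        Pxx \in unitmx
      & K = Puy - Pux *m invmx Pxx *m Pxy]].

Definition C_M1 (R : realType) n m p (A : 'M[R]_n) (B : 'M[R]_(n, m))
    (C : 'M[R]_(p, n)) (T : nat) : set 'M[ratfun R]_(m, p) :=
  [set K | exists (Pyx : 'M[ratfun R]_(p, n)) (Pyy : 'M[ratfun R]_p)
                  (Pux : 'M[ratfun R]_(m, n)) (Puy : 'M[ratfun R]_(m, p)),
    [/\ [/\ FIR T Pyx, FIR T Pyy, FIR T Pux & FIR T Puy],
        row_mx 1%:M (- plant_tf A B C) *m block_mx Pyx Pyy Pux Puy
          = row_mx (cstmx C *m invmx (zIsub A)) 1%:M,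
        block_mx Pyx Pyy Pux Puy *m col_mx (zIsub A) (- cstmx C) = 0,
        Pyy \in unitmx
      & K = Puy *m invmx Pyy]].

Definition C_M2 (R : realType) n m p (A : 'M[R]_n) (B : 'M[R]_(n, m))
    (C : 'M[R]_(p, n)) (T : nat) : set 'M[ratfun R]_(m, p) :=
  [set K | exists (Pxy : 'M[ratfun R]_(n, p)) (Pxu : 'M[ratfun R]_(n, m))
                  (Puy : 'M[ratfun R]_(m, p)) (Puu : 'M[ratfun R]_m),
    [/\ [/\ FIR T Pxy, FIR T Puy, FIR T Pxu & FIR T Puu],
        row_mx (zIsub A) (- cstmx B) *m block_mx Pxy Pxu Puy Puu = 0,
        block_mx Pxy Pxu Puy Puu *m col_mx (- plant_tf A B C) 1%:M
          = col_mx (invmx (zIsub A) *m cstmx B) 1%:M,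
        Puu \in unitmx
      & K = invmx Puu *m Puy]].

Definition C_IOP (R : realType) n m p (A : 'M[R]_n) (B : 'M[R]_(n, m))
    (C : 'M[R]_(p, n)) (T : nat) : set 'M[ratfun R]_(m, p) :=
  [set K | exists (Pyy : 'M[ratfun R]_p) (Pyu : 'M[ratfun R]_(p, m))
                  (Puy : 'M[ratfun R]_(m, p)) (Puu : 'M[ratfun R]_m),
    [/\ [/\ FIR T Pyy, FIR T Puy, FIR T Pyu & FIR T Puu],
        row_mx 1%:M (- plant_tf A B C) *m block_mx Pyy Pyu Puy Puu
          = row_mx 1%:M 0,
        block_mx Pyy Pyu Puy Puu *m col_mx (- plant_tf A B C) 1%:M
          = col_mx 0 1%:M,
        Pyy \in unitmx
      & K = Puy *m invmx Pyy]].

(* The controllers under consideration, on whose realizations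
   stabilizability/detectability resp. controllability/observability is
   imposed. *)
Definition C_all (R : realType) n m p (A : 'M[R]_n) (B : 'M[R]_(n, m))
    (C : 'M[R]_(p, n)) (T : nat) : set 'M[ratfun R]_(m, p) :=
  C_SLP A B C T `|` C_M1 A B C T `|` C_M2 A B C T `|` C_IOP A B C T.

(* Main.v *)
Require Import Defs.
From HB Require Import structures.
From mathcomp Require Import all_boot all_order all_algebra.
From mathcomp Require Import complex.
From mathcomp Require Import all_classical all_reals all_analysis.
From mathcomp Require Import zify ring.

(* Write [M = zI - A] and [G = C M^-1 B]. In each parameterization the
   constraints determine every block from [Q = Phi_uy], and the controller is
   characterized by [K (I + G Q) = Q]. The four sets thus differ only in which
   blocks must be FIR:
     SLP:  Q,  Q C M^-1,  M^-1 B Q,  X    with X = M^-1 + M^-1 B Q C M^-1;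
     M1:   Q,  Q C M^-1,  I + G Q,   C X;
     M2:   Q,  M^-1 B Q,  I + Q G,   X B;
     IOP:  Q,  I + G Q,   I + Q G,   C X B.
   Multiplying by [C] on the left or [B] on the right gives the inclusions.
   Conversely, if [Y] is strictly proper and [Y M], [Y B] are FIR of horizon
   [T], then so are all [Y A^i B], hence [Y] when [(A, B)] is controllable; the
   dual argument uses observability.

   For stability, the resolvent of the closed-loop matrix is shown to have no
   pole [l] with [|l| >= 1]. The condition "[Y M] and [Y B] regular at [l]
   implies [Y] regular at [l]" follows from stabilizability as well as from
   controllability, is invariant under feedback and passes to block-diagonal
   systems; with its dual it reduces the claim to regularity of the closed-loop
   transfer matrix, which is expressed through the FIR blocks. *)

Set Implicit Arguments.
Unset Strict Implicit.
Unset Printing Implicit Defensive.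

Import Order.TTheory GRing.Theory Num.Theory.
Import numFieldNormedType.Exports.
Local Open Scope classical_set_scope.
Local Open Scope ring_scope.

(** * Rational functions, constant matrices and the pencil [zI - A] *)

Lemma frac_add (D : idomainType) (a b c d : D) : b != 0 -> d != 0 ->
  tofrac a / tofrac b + tofrac c / tofrac d
  = tofrac (a * d + c * b) / tofrac (b * d).
Proof. by move=> b0 d0; rewrite addf_div ?tofrac_eq0// -!tofracM -tofracD. Qed.

Lemma frac_mul (D : idomainType) (a b c d : D) :
  (tofrac a / tofrac b) * (tofrac c / tofrac d)
  = tofrac (a * c) / tofrac (b * d).
Proof. by rewrite mulf_div -!tofracM. Qed.

(** Named so that it can carry a ring morphism structure: [cstmx] is then [map_mx ratC] by
    conversion and inherits the morphism lemmas. *)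
Definition ratC (R : realType) (c : R) : ratfun R := tofrac c%:P.

HB.instance Definition _ (R : realType) :=
  GRing.RMorphism.copy (@ratC R) (@tofrac {poly R} \o polyC).

Lemma cstmxE (R : realType) m n (M : 'M[R]_(m, n)) i j :
  cstmx M i j = ratC (M i j).
Proof. by rewrite mxE. Qed.

Lemma cstmx_map (R : realType) m n (M : 'M[R]_(m, n)) :
  cstmx M = map_mx (@ratC R) M.
Proof. by []. Qed.

Lemma cstmxD (R : realType) m n (M N : 'M[R]_(m, n)) :
  cstmx (M + N) = cstmx M + cstmx N.
Proof. by rewrite !cstmx_map map_mxD. Qed.

Lemma cstmxM (R : realType) m n p (M : 'M[R]_(m, n)) (N : 'M[R]_(n, p)) :
  cstmx (M *m N) = cstmx M *m cstmx N.
Proof. by rewrite !cstmx_map map_mxM. Qed.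

Lemma cstmx1 (R : realType) n : cstmx (1%:M : 'M[R]_n) = 1%:M.
Proof. by rewrite cstmx_map map_mx1. Qed.

Lemma cstmx0 (R : realType) m n : cstmx (0 : 'M[R]_(m, n)) = 0.
Proof. by rewrite cstmx_map map_mx0. Qed.

Lemma tr_cstmx (R : realType) m n (M : 'M[R]_(m, n)) : (cstmx M)^T = cstmx M^T.
Proof. by rewrite /cstmx map_trmx. Qed.

Lemma cstmx_block (R : realType) m1 m2 n1 n2 (A : 'M[R]_(m1, n1))
    (B : 'M[R]_(m1, n2)) (C : 'M[R]_(m2, n1)) (D : 'M[R]_(m2, n2)) :
  cstmx (block_mx A B C D) = block_mx (cstmx A) (cstmx B) (cstmx C) (cstmx D).
Proof. by rewrite /cstmx map_block_mx. Qed.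

Lemma tr_zIsub (R : realType) n (A : 'M[R]_n) : (zIsub A)^T = zIsub A^T.
Proof. by rewrite /zIsub raddfB /= tr_scalar_mx tr_cstmx. Qed.

(** Moves determinants and adjugates of [zI - A] to polynomial matrices, which makes [char_poly A] a
    denominator of the resolvent. *)
Lemma zIsubE (R : realType) n (A : 'M[R]_n) :
  zIsub A = map_mx (@tofrac {poly R}) (char_poly_mx A).
Proof.
by apply/matrixP => i j; rewrite !mxE raddfB; case: (i == j); rewrite /= ?tofrac0.
Qed.

Lemma det_zIsub (R : realType) n (A : 'M[R]_n) :
  \det (zIsub A) = tofrac (char_poly A).
Proof. by rewrite zIsubE det_map_mx. Qed.

Lemma char_poly_neq0 (R : nzRingType) n (A : 'M[R]_n) : char_poly A != 0.
Proof. exact/monic_neq0/char_poly_monic. Qed.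

Lemma zIsub_unit (R : realType) n (A : 'M[R]_n) : zIsub A \in unitmx.
Proof.
by rewrite unitmxE unitfE det_zIsub tofrac_eq0 char_poly_neq0.
Qed.

Lemma zvar_neq0 (R : realType) : zvar R != 0.
Proof. by rewrite tofrac_eq0 polyX_eq0. Qed.

(** * Properness *)

Lemma proper_ratC (R : realType) (c : R) : proper_ratfun (ratC c).
Proof.
exists c%:P, 1; split; rewrite ?oner_neq0 ?size_poly1 ?size_polyC_leq1 //.
by rewrite tofrac1 divr1.
Qed.

Lemma proper_ratfunD (R : realType) (f g : ratfun R) :
  proper_ratfun f -> proper_ratfun g -> proper_ratfun (f + g).
Proof.
move=> [a [b [b0 sab ->]]] [c [d [d0 scd ->]]].
exists (a * d + c * b), (b * d); split; rewrite ?mulf_neq0 ?frac_add//.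
rewrite (leq_trans (size_polyD _ _))// geq_max; apply/andP; split.
  by rewrite (leq_trans (size_polyMleq _ _))// size_mul//
    -!subn1 leq_sub2r// leq_add2r.
rewrite (leq_trans (size_polyMleq _ _))// size_mul// -!subn1 leq_sub2r// addnC.
by rewrite leq_add2l.
Qed.

Lemma proper_ratfunM (R : realType) (f g : ratfun R) :
  proper_ratfun f -> proper_ratfun g -> proper_ratfun (f * g).
Proof.
move=> [a [b [b0 sab ->]]] [c [d [d0 scd ->]]].
exists (a * c), (b * d); split; rewrite ?mulf_neq0 ?frac_mul//.
by rewrite (leq_trans (size_polyMleq _ _))// size_mul//
  -!subn1 leq_sub2r// leq_add.
Qed.

Lemma proper_zVn (R : realType) k : proper_ratfun (zvar R ^- k).
Proof.
exists 1, 'X^k; split; rewrite ?monic_neq0 ?monicXn ?size_polyXn ?size_poly1//.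
by rewrite tofrac1 div1r tofracXn.
Qed.

(** Vanishing at infinity, phrased through [z f] so that closure properties reduce to those of
    proper fractions. *)
Definition strictly_proper (R : realType) (f : ratfun R) :=
  proper_ratfun (zvar R * f).

Lemma strictly_properM (R : realType) (f g : ratfun R) :
  strictly_proper f -> proper_ratfun g -> strictly_proper (f * g).
Proof.
by rewrite /strictly_proper => sf pg; rewrite mulrA; apply: proper_ratfunM.
Qed.

Lemma strictly_properD (R : realType) (f g : ratfun R) :
  strictly_proper f -> strictly_proper g -> strictly_proper (f + g).
Proof.
by rewrite /strictly_proper => sf pg; rewrite mulrDr; apply: proper_ratfunD.
Qed.

Lemma strictly_proper_proper (R : realType) (f : ratfun R) :
  strictly_proper f -> proper_ratfun f.
Proof.
move=> sf; rewrite -[f](mulKf (zvar_neq0 R)).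
exact: proper_ratfunM (proper_zVn R 1) sf.
Qed.

(** * Entrywise predicates and controllability *)

Definition mxall (F : Type) (P : F -> Prop) m n (H : 'M[F]_(m, n)) :=
  forall i j, P (H i j).

(** [R]-linear subspaces of [R(z)]. FIR, strictly proper and regular fractions are all of this kind,
    so one controllability argument serves both for horizons and for poles. *)
Definition lin_closed (R : realType) (P : ratfun R -> Prop) :=
  [/\ P 0, forall f g, P f -> P g -> P (f + g)
    & forall c f, P f -> P (ratC c * f)].

Lemma lin_closed_sum (R : realType) (P : ratfun R -> Prop) (I : finType)
    (F : I -> ratfun R) :
  lin_closed P -> (forall i, P (F i)) -> P (\sum_i F i).
Proof. by move=> [P0 PD _] PF; apply: big_ind. Qed.

Section EntrywiseClosure.
Variables (R : realType) (P : ratfun R -> Prop).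
Hypothesis Plin : lin_closed P.

Lemma mxallD m n (H K : 'M[ratfun R]_(m, n)) :
  mxall P H -> mxall P K -> mxall P (H + K).
Proof. by case: Plin => _ PD _ PH PK i j; rewrite mxE; apply: PD. Qed.

Lemma mxallN m n (H : 'M[ratfun R]_(m, n)) : mxall P H -> mxall P (- H).
Proof.
case: Plin => _ _ PZ PH i j; rewrite mxE -mulN1r.
by rewrite -(rmorphN1 (@ratC R)); apply: PZ.
Qed.

Lemma mxallB m n (H K : 'M[ratfun R]_(m, n)) :
  mxall P H -> mxall P K -> mxall P (H - K).
Proof. by move=> PH PK; apply: mxallD => //; apply: mxallN. Qed.

Lemma mxall_cstl m n p (M : 'M[R]_(m, n)) (H : 'M[ratfun R]_(n, p)) :
  mxall P H -> mxall P (cstmx M *m H).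
Proof.
move=> PH i j; rewrite mxE; apply: lin_closed_sum => [//|k].
by rewrite cstmxE; case: Plin => _ _ PZ; exact: PZ (PH _ _).
Qed.

Lemma mxall_cstr m n p (H : 'M[ratfun R]_(m, n)) (M : 'M[R]_(n, p)) :
  mxall P H -> mxall P (H *m cstmx M).
Proof.
move=> PH i j; rewrite mxE; apply: lin_closed_sum => [//|k].
by rewrite cstmxE mulrC; case: Plin => _ _ PZ; exact: PZ (PH _ _).
Qed.

End EntrywiseClosure.

Lemma mxall_tr (F : Type) (P : F -> Prop) m n (H : 'M[F]_(m, n)) :
  mxall P H^T -> mxall P H.
Proof. by move=> PH i j; have := PH j i; rewrite mxE. Qed.

Lemma tr_mxall (F : Type) (P : F -> Prop) m n (H : 'M[F]_(m, n)) :
  mxall P H -> mxall P H^T.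
Proof. by move=> PH i j; rewrite mxE. Qed.

Lemma mulmx_zIsub (R : realType) n k (A : 'M[R]_n) (Y : 'M[ratfun R]_(k, n)) :
  Y *m cstmx A = zvar R *: Y - Y *m zIsub A.
Proof. by rewrite /zIsub mulmxBr mul_mx_scalar subKr. Qed.

(* [Y A^(i+1) B = z (Y A^i B) - (Y (zI - A)) A^i B], so the property passes
   from [Y B] to all [Y A^i B], and the controllability matrix is right
   invertible. *)
Lemma controllable_mxall (R : realType) n m (A : 'M[R]_n) (B : 'M[R]_(n, m))
    (P S : ratfun R -> Prop) :
  lin_closed P -> lin_closed S -> (forall f, S f -> P f -> P (zvar R * f)) ->
  controllable A B ->
  forall k (Y : 'M[ratfun R]_(k, n)), mxall S Y ->
  mxall P (Y *m zIsub A) -> mxall P (Y *m cstmx B) -> mxall P Y.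
Proof.
move=> Pl Sl PS ctr k Y SY PYM PYB.
have PYi i : mxall P (Y *m cstmx (A ^+ i *m B)).
  elim: i => [|i IH]; first by rewrite expr0 -idmxE mul1mx.
  rewrite exprS -mulmxA cstmxM mulmxA mulmx_zIsub mulmxBl -scalemxAl.
  apply: (mxallB Pl); last exact: mxall_cstr.
  (* [Y A^i B] is in [S] as well, and there multiplication by [z] preserves [P]. *)
  by move=> r c; rewrite mxE; apply: PS => //; apply: mxall_cstr.
have /row_freeP[X CX] : row_free (\mxrow_(i < n) (A ^+ i *m B)).
  exact/eqP.
rewrite -[Y]mulmx1 -cstmx1 -CX -[X]submxcolK mul_mxrow_mxcol.
rewrite cstmx_map map_mx_sum.
rewrite mulmx_sumr => r c; rewrite summxE; apply: lin_closed_sum => // i.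
by rewrite -cstmx_map cstmxM mulmxA; apply: mxall_cstr.
Qed.

Lemma trmx_exp (R : realType) n (A : 'M[R]_n) i : (A ^+ i)^T = A^T ^+ i.
Proof.
by elim: i => [|i IH]; rewrite ?expr0 -?idmxE ?trmx1// exprS exprSr trmx_mul IH.
Qed.

Lemma observable_tr (R : realType) n p (A : 'M[R]_n) (C : 'M[R]_(p, n)) :
  observable A C -> controllable A^T C^T.
Proof.
rewrite /observable /controllable -mxrank_tr tr_mxcol => obs.
rewrite -[RHS]obs.
by congr (\rank _); apply/eq_mxrow => i; rewrite trmx_mul trmx_exp.
Qed.

(** Follows from [controllable_mxall] by transposition. *)
Lemma observable_mxall (R : realType) n p (A : 'M[R]_n) (C : 'M[R]_(p, n))
    (P S : ratfun R -> Prop) :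
  lin_closed P -> lin_closed S -> (forall f, S f -> P f -> P (zvar R * f)) ->
  observable A C ->
  forall k (X : 'M[ratfun R]_(n, k)), mxall S X ->
  mxall P (zIsub A *m X) -> mxall P (cstmx C *m X) -> mxall P X.
Proof.
move=> Pl Sl PS /observable_tr obs k X SX PMX PCX; apply: mxall_tr.
apply: (controllable_mxall Pl Sl PS obs); first exact: tr_mxall.
  by rewrite -tr_zIsub -trmx_mul; apply: tr_mxall.
by rewrite -tr_cstmx -trmx_mul; apply: tr_mxall.
Qed.

(** * Finite impulse responses *)

(** Entrywise form of [FIR] without coefficients: properness bounds the degree of [q] by [T], and
    stability is automatic since only [0] can be a pole. *)
Definition fir (R : realType) (T : nat) (f : ratfun R) :=
  proper_ratfun f /\ exists q : {poly R}, f * zvar R ^+ T = tofrac q.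

Lemma fir_lin_closed (R : realType) T : lin_closed (@fir R T).
Proof.
split=> [|f g [pf [q fq]] [pg [r gr]]|c f [pf [q fq]]].
- split; first by have := proper_ratC (0 : R); rewrite rmorph0.
  by exists 0; rewrite mul0r tofrac0.
- split; first exact: proper_ratfunD.
  by exists (q + r); rewrite mulrDl fq gr tofracD.
- split; first exact: proper_ratfunM (proper_ratC c) pf.
  by exists (c%:P * q); rewrite -mulrA fq -tofracM.
Qed.

Lemma strictly_proper_lin_closed (R : realType) : lin_closed (@strictly_proper R).
Proof.
split=> [|f g|c f sf]; last 2 first.
- exact: strictly_properD.
- by rewrite mulrC; apply: strictly_properM (proper_ratC c).
by rewrite /strictly_proper mulr0 -(rmorph0 (@ratC R)); apply: proper_ratC.
Qed.

(** Strict properness kills the coefficient of [z^0], so the shift by [z] does not exceed the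
    horizon. *)
Lemma fir_zM (R : realType) T (f : ratfun R) :
  strictly_proper f -> fir T f -> fir T (zvar R * f).
Proof.
move=> sf [pf [q fq]]; split=> //.
by exists ('X * q); rewrite -mulrA fq -tofracM.
Qed.

Lemma fir1 (R : realType) T n : mxall (fir T) (1%:M : 'M[ratfun R]_n).
Proof.
move=> i j; rewrite -cstmx1 cstmxE; split; first exact: proper_ratC.
by exists ((1%:M : 'M[R]_n) i j *: 'X^T); rewrite -mul_polyC tofracM tofracXn.
Qed.

Lemma FIR_fir (R : realType) T m n (H : 'M[ratfun R]_(m, n)) :
  FIR T H -> mxall (fir T) H.
Proof.
move=> [[pH _] [Hk ->]] i j; split.
  rewrite summxE; apply: big_ind => [||k _].
  - by rewrite -(rmorph0 (@ratC R)); apply: proper_ratC.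
  - exact: proper_ratfunD.
  by rewrite mxE cstmxE; apply: proper_ratfunM (proper_zVn _ _) (proper_ratC _).
exists (\sum_(0 <= k < T.+1) (Hk k i j)%:P * 'X^(T - k)).
rewrite summxE mulr_suml rmorph_sum /= big_nat_cond [RHS]big_nat_cond.
apply: eq_bigr => k /andP[/andP[_ kT] _].
have zT : zvar R ^+ T = zvar R ^+ k * zvar R ^+ (T - k) by rewrite -exprD subnKC.
rewrite mxE cstmxE tofracM tofracXn -/(zvar R) zT mulrACA mulVf.
  by rewrite mul1r.
by rewrite expf_neq0 ?zvar_neq0.
Qed.

(** Stated for an arbitrary representative [a / b], because properness and poles each come with one
    of their own. *)
Lemma fir_frac (R : realType) T (f : ratfun R) (q a b : {poly R}) :
  b != 0 -> f = tofrac a / tofrac b -> f * zvar R ^+ T = tofrac q ->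
  a * 'X^T = q * b.
Proof.
move=> b0 fab; rewrite fab mulrAC => fq.
apply/eqP; rewrite -tofrac_eq !tofracM tofracXn -fq mulfVK ?tofrac_eq0//.
Qed.

(** Compare sizes in [a * 'X^T = q * b], where [size a <= size b]. *)
Lemma fir_size (R : realType) T (f : ratfun R) (q : {poly R}) :
  proper_ratfun f -> f * zvar R ^+ T = tofrac q -> (size q <= T.+1)%N.
Proof.
move=> [a [b [b0 sab fab]]] /(fir_frac b0 fab) aq.
have [->|q0] := eqVneq q 0; first by rewrite size_poly0.
have a0 : a != 0.
  apply: contra_neq (mulf_neq0 q0 b0) => a0.
  by rewrite -aq a0 mul0r.
have /(congr1 (fun r : {poly R} => size r)) := aq.
rewrite size_mulXn// size_mul// => sqb.
have sb : (0 < size b)%N by rewrite size_poly_gt0.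
have arith (x y z : nat) :
  (T + x = (y + z).-1 -> x <= z -> 0 < z -> y <= T.+1)%N by lia.
exact: arith sqb sab sb.
Qed.

Lemma fir_FIR (R : realType) T m n (H : 'M[ratfun R]_(m, n)) :
  mxall (fir T) H -> FIR T H.
Proof.
move=> fH; split; first split.
- by move=> i j; case: (fH i j).
- move=> i j l [a [b [b0 cab Hab rbl]]].
  have [_ [q /(fir_frac b0 Hab) aq]] := fH i j.
  (* In lowest terms the denominator divides a power of [z], so [0] is the only possible pole. *)
  have bX : b %| 'X^T.
    have : b %| a * 'X^T by rewrite aq dvdp_mulIr.
    by rewrite Gauss_dvdpr// coprimep_sym.
  have : root (map_poly (real_complex R) 'X^T) l.
    by have [c ->] := dvdpP _ _ bX; rewrite rmorphM rootM rbl orbT.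
  rewrite map_polyXn rootE hornerXn expf_eq0 => /andP[_ /eqP ->].
  by rewrite normr0 ltr01.
have /choice[Q QE] : forall i, exists Qi : 'I_n -> {poly R},
    forall j, H i j * zvar R ^+ T = tofrac (Qi j).
  move=> i; have /choice[Qi QiE] : forall j, exists q : {poly R},
      H i j * zvar R ^+ T = tofrac q by move=> j; case: (fH i j).
  by exists Qi.
(* In [q / z^T] the coefficient of [z^-k] is that of degree [T - k] in [q]; [fir_size] excludes
   higher degrees. *)
exists (fun k => \matrix_(i, j) (Q i j)`_(T - k)).
apply/matrixP => i j; have [pH _] := fH i j.
rewrite summxE -[LHS](mulfK (expf_neq0 T (zvar_neq0 R))) QE.
have sQ := fir_size pH (QE i j).
rewrite -{1}(take_poly_id sQ) /take_poly poly_def rmorph_sum /= mulr_suml.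
rewrite big_mkord [RHS](reindex_inj rev_ord_inj) /=; apply: eq_bigr => k _.
have kT : (k <= T)%N by rewrite -ltnS.
rewrite !mxE subSS subKn// -mul_polyC tofracM tofracXn -/(zvar R).
have -> : zvar R ^+ T = zvar R ^+ k * zvar R ^+ (T - k) by rewrite -exprD subnKC.
have zk0 : zvar R ^+ k != 0 by rewrite expf_neq0 ?zvar_neq0.
by rewrite invfM -mulrA mulVKf// mulrC.
Qed.

(** * Values at infinity and proper inverses *)

Lemma mul_subr1_eq (F : fieldType) (f u v w : F) : u != 0 -> w != 0 ->
  w * (f - 1) = v / u -> f = (u * w + v) / (u * w).
Proof.
move=> u0 w0 fE; have uw0 : u * w != 0 by rewrite mulf_neq0.
apply: (mulIf uw0); rewrite divfK//.
have -> : v = w * (f - 1) * u by rewrite fE divfK.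
by rewrite mulrBr mulr1 mulrBl [w * u]mulrC addrC subrK [w * f]mulrC -mulrA
  [w * u]mulrC.
Qed.

(** Graph of the evaluation of proper fractions at infinity. As a ring morphism it commutes with
    sums, products and hence determinants. *)
Definition value_at_infty (R : realType) (f : ratfun R) (c : R) :=
  strictly_proper (f - ratC c).

Lemma value_at_infty_proper (R : realType) (f : ratfun R) c :
  value_at_infty f c -> proper_ratfun f.
Proof.
move=> /strictly_proper_proper fc; rewrite -(subrK (ratC c) f).
exact: proper_ratfunD (proper_ratC c).
Qed.

Lemma value_at_inftyC (R : realType) (c : R) : value_at_infty (ratC c) c.
Proof.
by rewrite /value_at_infty subrr; case: (strictly_proper_lin_closed R).
Qed.

Lemma value_at_inftyD (R : realType) (f g : ratfun R) c d :
  value_at_infty f c -> value_at_infty g d -> value_at_infty (f + g) (c + d).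
Proof.
rewrite /value_at_infty rmorphD opprD addrACA; exact: strictly_properD.
Qed.

Lemma value_at_inftyM (R : realType) (f g : ratfun R) c d :
  value_at_infty f c -> value_at_infty g d -> value_at_infty (f * g) (c * d).
Proof.
move=> fc gd; rewrite /value_at_infty rmorphM.
have -> : f * g - ratC c * ratC d = (f - ratC c) * g + (g - ratC d) * ratC c.
  by rewrite mulrBl mulrBl addrA (mulrC g) subrK (mulrC (ratC d)).
apply: strictly_properD; apply: strictly_properM => //.
  exact: value_at_infty_proper gd.
exact: proper_ratC.
Qed.

Lemma value_at_infty_det (R : realType) n (H : 'M[ratfun R]_n) (M : 'M[R]_n) :
  (forall i j, value_at_infty (H i j) (M i j)) -> value_at_infty (\det H)
    (\det M).
Proof.
move=> HM; apply: (big_ind2 (@value_at_infty R)) => [||s _].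
- by rewrite -(rmorph0 (@ratC R)); apply: value_at_inftyC.
- by move=> ? ? ? ?; apply: value_at_inftyD.
apply: value_at_inftyM.
  by rewrite -(rmorph_sign (@ratC R)); apply: value_at_inftyC.
apply: (big_ind2 (@value_at_infty R)) => [||i _]; last exact: HM.
- by rewrite -(rmorph1 (@ratC R)); apply: value_at_inftyC.
- by move=> ? ? ? ?; apply: value_at_inftyM.
Qed.

(** From [z (f - 1) = a / b] one gets [f = (b z + a) / (b z)], whose numerator and denominator have
    the same size. *)
Lemma value_at_infty_inv (R : realType) (f : ratfun R) :
  value_at_infty f 1 -> proper_ratfun f^-1.
Proof.
rewrite /value_at_infty rmorph1 => -[a [b [b0 sab fab]]].
have zX : zvar R = tofrac 'X by [].
have sa : (size a < size (b * 'X)%R)%N by rewrite size_mulX.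
have s0 : size (b * 'X + a) = size (b * 'X) by rewrite size_polyDl.
have bX0 : b * 'X != 0 by rewrite mulf_neq0// polyX_eq0.
have ba0 : b * 'X + a != 0 by rewrite -size_poly_eq0 s0 size_poly_eq0.
exists (b * 'X), (b * 'X + a); split; rewrite ?s0//.
have bF : tofrac b != 0 by rewrite tofrac_eq0.
have XF : tofrac 'X != 0 :> ratfun R by rewrite tofrac_eq0 polyX_eq0.
have fE := mul_subr1_eq bF XF fab.
by rewrite fE -tofracM -tofracD invf_div.
Qed.

(** [H] is the identity at infinity, so [\det H] has value 1 there and its inverse is proper;
    cofactors are determinants of proper entries. *)
Lemma proper_invmx (R : realType) n (H : 'M[ratfun R]_n) :
  mxall (@strictly_proper R) (H - 1%:M) -> mxall (@proper_ratfun R) (invmx H).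
Proof.
move=> H1.
have val i j : value_at_infty (H i j) ((1%:M : 'M[R]_n) i j).
  have := H1 i j; rewrite /value_at_infty !mxE.
  by case: (i == j); rewrite ?rmorph1 ?rmorph0.
have dH : value_at_infty (\det H) 1.
  by rewrite -(det1 R n); apply: value_at_infty_det.
(* Outside [unitmx], [invmx H] defaults to [H], whose entries are proper. *)
rewrite /invmx; case: ifP => _ i j; last exact: value_at_infty_proper (val i j).
rewrite !mxE; apply: proper_ratfunM; first exact: value_at_infty_inv.
apply: proper_ratfunM.
  by rewrite -(rmorph_sign (@ratC R)); apply: proper_ratC.
apply: value_at_infty_proper (\det (row' j (col' i 1%:M))) _.
apply: value_at_infty_det => k l.
by have := val (lift j k) (lift i l); rewrite !mxE.
Qed.

(** Write [zI - A = z N] with [N = I - z^-1 A], which is the identity at infinity; the resolvent is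
    [z^-1] times the proper matrix [N^-1]. *)
Lemma strictly_proper_resolvent (R : realType) n (A : 'M[R]_n) :
  mxall (@strictly_proper R) (invmx (zIsub A)).
Proof.
set N : 'M[ratfun R]_n := 1%:M - (zvar R)^-1 *: cstmx A.
have MN : zIsub A = zvar R *: N.
  by rewrite scalerBr scalemx1 scalerA divff ?scale1r ?zvar_neq0.
have pN : mxall (@proper_ratfun R) (invmx N).
  apply: proper_invmx => i j; rewrite addrAC subrr add0r !mxE.
  rewrite -mulrN /strictly_proper mulVKf ?zvar_neq0//.
  by have := proper_ratC (- A i j); rewrite rmorphN.
have NU : N \in unitmx.
  by have := zIsub_unit A; rewrite MN unitmxZ// unitfE zvar_neq0.
move=> i j; rewrite MN invmxZ; last by rewrite -MN zIsub_unit.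
by rewrite mxE /strictly_proper mulVKf ?zvar_neq0//; apply: pN.
Qed.

(** * Algebra of the four parameterizations *)

(* [youla G Q K] says that [Q] is the closed-loop map [K (I - G K)^-1] from
   measurement noise to control. *)
Definition youla (F : comUnitRingType) p m (G : 'M[F]_(p, m))
    (Q K : 'M[F]_(m, p)) :=
  1%:M + G *m Q \in unitmx /\ K *m (1%:M + G *m Q) = Q.

Section Youla.
Variables (F : comUnitRingType) (m p : nat) (G : 'M[F]_(p, m)).
Implicit Types Q K : 'M[F]_(m, p).

(** The equation itself makes [I - G K] a left inverse of [I + G Q]. *)
Lemma youla_intro Q K : K *m (1%:M + G *m Q) = Q -> youla G Q K.
Proof.
move=> KQ; split=> //.
suff /mulmx1_unit[] : (1%:M - G *m K) *m (1%:M + G *m Q) = 1%:M by [].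
by rewrite mulmxBl mul1mx -!mulmxA KQ addrK.
Qed.

Lemma youlaE Q K : youla G Q K -> Q = K + Q *m G *m K.
Proof.
case=> U KQ; have -> : K = Q *m invmx (1%:M + G *m Q) by rewrite -{1}KQ mulmxK.
rewrite mulmxA -mulmxDl -[X in X + _]mulmx1 -(mulmxA Q) -mulmxDr.
by rewrite mulmxK.
Qed.

Lemma youla_right_mul Q K : youla G Q K -> Q - K *m G *m Q = K.
Proof.
by case=> U KQ; rewrite -[X in X - _]KQ mulmxDr mulmx1 mulmxA addrK.
Qed.

Lemma youla_left_unit Q K : youla G Q K ->
  1%:M + Q *m G \in unitmx /\ (1%:M + Q *m G) *m K = Q.
Proof.
move=> /youlaE QE.
have KQ : (1%:M + Q *m G) *m K = Q by rewrite mulmxDl mul1mx -QE.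
split=> //; suff /mulmx1_unit[] : (1%:M + Q *m G) *m (1%:M - K *m G) = 1%:M by [].
by rewrite mulmxBr mulmx1 mulmxA KQ addrK.
Qed.

(** Push-through identity [Q (I + G Q) = (I + Q G) Q]. *)
Lemma youla_left Q : 1%:M + Q *m G \in unitmx ->
  youla G Q (invmx (1%:M + Q *m G) *m Q).
Proof.
move=> U; set P := 1%:M + _ in U *.
have QP : Q *m (1%:M + G *m Q) = P *m Q.
  by rewrite mulmxDr mulmxDl mulmx1 mul1mx mulmxA.
by apply: youla_intro; rewrite -mulmxA QP mulKmx.
Qed.

End Youla.

Section Parameterizations.
Variables (F : comUnitRingType) (n m p : nat).
Variables (M : 'M[F]_n) (B : 'M[F]_(n, m)) (C : 'M[F]_(p, n)).
Hypothesis M_unit : M \in unitmx.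
Local Notation G := (C *m invmx M *m B).
Implicit Types Q K : 'M[F]_(m, p).

Lemma solve_left k (X : 'M[F]_(n, k)) Y : M *m X = Y -> X = invmx M *m Y.
Proof. by move=> <-; rewrite mulKmx. Qed.

Lemma solve_right k (X : 'M[F]_(k, n)) Y : X *m M = Y -> X = Y *m invmx M.
Proof. by move=> <-; rewrite mulmxK. Qed.

Lemma mul_slp_xx Q :
  M *m (invmx M + invmx M *m B *m Q *m C *m invmx M)
  = 1%:M + B *m (Q *m C *m invmx M).
Proof. by rewrite mulmxDr mulmxV// !mulmxA mulmxV// mul1mx. Qed.

Lemma slp_xx_mul Q :
  (invmx M + invmx M *m B *m Q *m C *m invmx M) *m M
  = 1%:M + invmx M *m B *m Q *m C.
Proof. by rewrite mulmxDl mulVmx// mulmxKV. Qed.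

Lemma slp_youla Pxx Pxy Pux Q :
  row_mx M (- B) *m block_mx Pxx Pxy Pux Q = row_mx 1%:M 0 ->
  block_mx Pxx Pxy Pux Q *m col_mx M (- C) = col_mx 1%:M 0 ->
  Pxx \in unitmx ->
  [/\ youla G Q (Q - Pux *m invmx Pxx *m Pxy),
      Pxy = invmx M *m B *m Q, Pux = Q *m C *m invmx M &
      Pxx = invmx M + invmx M *m B *m Q *m C *m invmx M].
Proof.
rewrite mul_row_block mul_block_col !mulNmx !mulmxN => /eq_row_mx[/eqP e1 /eqP e2].
move=> /eq_col_mx[/eqP e3 /eqP e4] U.
rewrite !subr_eq ?add0r in e1 e2 e3 e4.
move/eqP in e1; move/eqP in e2; move/eqP in e3; move/eqP in e4.
have xyE : Pxy = invmx M *m B *m Q by rewrite (solve_left e2) mulmxA.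
have uxE : Pux = Q *m C *m invmx M by rewrite (solve_right e4).
have xxE : Pxx = invmx M + invmx M *m B *m Q *m C *m invmx M.
  by rewrite (solve_left e1) mulmxDr mulmx1 uxE !mulmxA.
have GQ : G *m Q = C *m Pxy by rewrite xyE !mulmxA.
have KP : (Q - Pux *m invmx Pxx *m Pxy) *m (1%:M + G *m Q) = Q.
  (* Since [B Q = M Pxy] and [Pxx M = I + Pxy C]; this cancels the inverse of [Pxx] in the formula
     for [K]. *)
  have xyP : Pxy *m (1%:M + C *m Pxy) = Pxx *m B *m Q.
    rewrite mulmxDr mulmx1 mulmxA -[X in X + _]mul1mx -mulmxDl -e3.
    by rewrite -mulmxA e2 mulmxA.
  rewrite mulmxBl GQ -(mulmxA _ Pxy) xyP -(mulmxA Pux) -(mulmxA Pxx) mulKmx//.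
  rewrite mulmxDr mulmx1 -e2 (mulmxA Pux) e4 mulmxA.
  by rewrite addrK.
by split=> //; apply: youla_intro.
Qed.

Lemma youla_slp Q K : youla G Q K ->
  let Pxx := invmx M + invmx M *m B *m Q *m C *m invmx M in
  let Pxy := invmx M *m B *m Q in
  let Pux := Q *m C *m invmx M in
  [/\ row_mx M (- B) *m block_mx Pxx Pxy Pux Q = row_mx 1%:M 0,
      block_mx Pxx Pxy Pux Q *m col_mx M (- C) = col_mx 1%:M 0,
      Pxx \in unitmx & K = Q - Pux *m invmx Pxx *m Pxy].
Proof.
move=> yQ Pxx Pxy Pux; have QE := youlaE yQ; have [U KQ] := yQ.
have MPxx : M *m Pxx = 1%:M + B *m Pux.
  exact: mul_slp_xx.
have PuxE : (K *m C) *m Pxx = Pux.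
  rewrite /Pxx /Pux -{2}KQ !mulmxDr mulmx1 mulmxDl mulmxDl !mulmxA.
  by [].
(* Identifies the inverse of [Pxx] as [M - B K C]. *)
have PP : (M - B *m K *m C) *m Pxx = 1%:M.
  by rewrite mulmxBl MPxx -!mulmxA (mulmxA K) PuxE addrK.
have [_ PU] := mulmx1_unit PP.
split=> //.
- rewrite mul_row_block !mulNmx MPxx addrK; congr row_mx.
  by rewrite /Pxy !mulmxA mulmxV// mul1mx subrr.
- rewrite mul_block_col !mulmxN; congr col_mx.
    by rewrite slp_xx_mul addrK.
  by rewrite /Pux mulmxKV// subrr.
- have -> : invmx Pxx = M - B *m K *m C.
    by rewrite -[RHS](mulmxK PU) PP mul1mx.
  (* The subtracted term becomes [Q G K], and [Q - Q G K = K] by [youlaE]. *)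
  have -> : Pux *m (M - B *m K *m C) *m Pxy = Q *m G *m (Q - K *m G *m Q).
    by rewrite /Pux /Pxy !(mulmxBr, mulmxBl) !mulmxA !(mulmxKV M_unit).
  rewrite (youla_right_mul yQ).
  by rewrite {1}QE addrK.
Qed.

Lemma mixed1_youla Pyx Pyy Pux Q :
  row_mx 1%:M (- G) *m block_mx Pyx Pyy Pux Q = row_mx (C *m invmx M) 1%:M ->
  block_mx Pyx Pyy Pux Q *m col_mx M (- C) = 0 ->
  Pyy \in unitmx ->
  [/\ youla G Q (Q *m invmx Pyy), Pyy = 1%:M + G *m Q,
      Pux = Q *m C *m invmx M &
      Pyx = C *m invmx M + G *m Q *m C *m invmx M].
Proof.
rewrite mul_row_block mul_block_col !mulNmx !mulmxN !mul1mx.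
move=> /eq_row_mx[/eqP e1 /eqP e2].
rewrite -col_mx0 => /eq_col_mx[/eqP e3 /eqP e4] U.
rewrite !subr_eq ?add0r in e1 e2 e3 e4.
move/eqP in e1; move/eqP in e2; move/eqP in e3; move/eqP in e4.
have uxE : Pux = Q *m C *m invmx M by rewrite (solve_right e4).
split=> //; last by rewrite e1 uxE !mulmxA.
by rewrite /youla -e2 mulmxKV.
Qed.

Lemma youla_mixed1 Q K : youla G Q K ->
  let Pyx := C *m invmx M + G *m Q *m C *m invmx M in
  let Pyy := 1%:M + G *m Q in
  let Pux := Q *m C *m invmx M in
  [/\ row_mx 1%:M (- G) *m block_mx Pyx Pyy Pux Q = row_mx (C *m invmx M) 1%:M,
      block_mx Pyx Pyy Pux Q *m col_mx M (- C) = 0,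
      Pyy \in unitmx & K = Q *m invmx Pyy].
Proof.
move=> [U KQ] Pyx Pyy Pux; split=> //; last by rewrite -{1}KQ mulmxK.
  by rewrite mul_row_block !mulNmx !mul1mx addrK /Pyx /Pux !mulmxA addrK.
rewrite mul_block_col !mulmxN -col_mx0; congr col_mx.
  by rewrite /Pyx /Pyy !mulmxDl !(mulmxKV M_unit) mul1mx subrr.
by rewrite mulmxKV// subrr.
Qed.

(** Here the controller is a left quotient, brought to the right-hand form of [youla] by
    [youla_left]. *)
Lemma mixed2_youla Pxy Pxu Q Puu :
  row_mx M (- B) *m block_mx Pxy Pxu Q Puu = 0 ->
  block_mx Pxy Pxu Q Puu *m col_mx (- G) 1%:M = col_mx (invmx M *m B) 1%:M ->
  Puu \in unitmx ->
  [/\ youla G Q (invmx Puu *m Q), Puu = 1%:M + Q *m G,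
      Pxy = invmx M *m B *m Q &
      Pxu = invmx M *m B + invmx M *m B *m Q *m G].
Proof.
rewrite mul_row_block mul_block_col !mulNmx !mulmxN !mulmx1.
rewrite -row_mx0 => /eq_row_mx[/eqP e1 /eqP e2].
rewrite ![- _ + _]addrC => /eq_col_mx[/eqP e3 /eqP e4] U.
rewrite !subr_eq ?add0r in e1 e2 e3 e4.
move/eqP in e1; move/eqP in e2; move/eqP in e3; move/eqP in e4.
have xyE : Pxy = invmx M *m B *m Q by rewrite (solve_left e1) mulmxA.
split=> //; last by rewrite e3 xyE.
by rewrite e4; apply: youla_left; rewrite -e4.
Qed.

Lemma youla_mixed2 Q K : youla G Q K ->
  let Pxy := invmx M *m B *m Q in
  let Pxu := invmx M *m B + invmx M *m B *m Q *m G in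
  let Puu := 1%:M + Q *m G in
  [/\ row_mx M (- B) *m block_mx Pxy Pxu Q Puu = 0,
      block_mx Pxy Pxu Q Puu *m col_mx (- G) 1%:M = col_mx (invmx M *m B) 1%:M,
      Puu \in unitmx & K = invmx Puu *m Q].
Proof.
move=> /youla_left_unit[U KQ] Pxy Pxu Puu; split=> //.
- rewrite mul_row_block !mulNmx -row_mx0; congr row_mx.
    by rewrite /Pxy !mulmxA mulmxV// mul1mx subrr.
  by rewrite /Pxu /Puu !mulmxDr !mulmxA mulmxV// !mul1mx mulmx1 subrr.
- rewrite mul_block_col !mulmxN !mulmx1 addrC /Pxu /Pxy addrK; congr col_mx.
  by rewrite /Puu addrC addrK.
- by rewrite -{1}KQ mulKmx.
Qed.

Lemma iop_youla Pyy Pyu Q Puu :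
  row_mx 1%:M (- G) *m block_mx Pyy Pyu Q Puu = row_mx 1%:M 0 ->
  block_mx Pyy Pyu Q Puu *m col_mx (- G) 1%:M = col_mx 0 1%:M ->
  Pyy \in unitmx ->
  [/\ youla G Q (Q *m invmx Pyy), Pyy = 1%:M + G *m Q,
      Puu = 1%:M + Q *m G & Pyu = G + G *m Q *m G].
Proof.
rewrite mul_row_block mul_block_col !mulNmx !mulmxN !mulmx1 !mul1mx.
move=> /eq_row_mx[/eqP e1 /eqP e2].
rewrite ![- _ + _]addrC => /eq_col_mx[/eqP e3 /eqP e4] U.
rewrite !subr_eq ?add0r in e1 e2 e3 e4.
move/eqP in e1; move/eqP in e2; move/eqP in e3; move/eqP in e4.
split=> //; first by rewrite /youla -e1 mulmxKV.
by rewrite e3 e1 mulmxDl mul1mx.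
Qed.

Lemma youla_iop Q K : youla G Q K ->
  let Pyy := 1%:M + G *m Q in
  let Pyu := G + G *m Q *m G in
  let Puu := 1%:M + Q *m G in
  [/\ row_mx 1%:M (- G) *m block_mx Pyy Pyu Q Puu = row_mx 1%:M 0,
      block_mx Pyy Pyu Q Puu *m col_mx (- G) 1%:M = col_mx 0 1%:M,
      Pyy \in unitmx & K = Q *m invmx Pyy].
Proof.
move=> [U KQ] Pyy Pyu Puu; split=> //; last by rewrite -{1}KQ mulmxK.
  rewrite mul_row_block !mulNmx !mul1mx /Pyy addrK; congr row_mx.
  by rewrite /Pyu /Puu mulmxDr mulmx1 (mulmxA G Q) subrr.
rewrite mul_block_col !mulmxN !mulmx1 /Pyy /Pyu /Puu; congr col_mx.
  by rewrite mulmxDl mul1mx addNr.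
by rewrite addrC addrK.
Qed.

End Parameterizations.

(** * The four sets in terms of [Q], and their inclusions *)

Section FIRParameterizations.
Variables (R : realType) (n m p T : nat).
Variables (A : 'M[R]_n) (B : 'M[R]_(n, m)) (C : 'M[R]_(p, n)).
Local Notation Mi := (invmx (zIsub A)).
Local Notation Bz := (cstmx B).
Local Notation Cz := (cstmx C).
Local Notation G := (Cz *m Mi *m Bz).
Local Notation fir_mx := (mxall (fir T)).
Local Notation slp_xx Q := (Mi + Mi *m Bz *m Q *m Cz *m Mi).
Implicit Types Q K : 'M[ratfun R]_(m, p).

Let lin := @fir_lin_closed R T.

Lemma C_SLPP K : C_SLP A B C T K <-> exists Q, youla G Q K /\
  [/\ fir_mx Q, fir_mx (Q *m Cz *m Mi), fir_mx (Mi *m Bz *m Q)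
    & fir_mx (slp_xx Q)].
Proof.
split=> [[Pxx [Pxy [Pux [Q [[Fxx Fux Fxy FQ] e1 e2 U ->]]]]]|
         [Q [/(youla_slp (zIsub_unit A))[e1 e2 U ->] [FQ Fux Fxy Fxx]]]].
  have [yQ xyE uxE xxE] := slp_youla (zIsub_unit A) e1 e2 U.
  exists Q; split=> //.
  by split; [|rewrite -uxE|rewrite -xyE|rewrite -xxE]; apply: FIR_fir.
exists (slp_xx Q), (Mi *m Bz *m Q), (Q *m Cz *m Mi), Q.
by split=> //; split; apply: fir_FIR.
Qed.

Lemma C_M1P K : C_M1 A B C T K <-> exists Q, youla G Q K /\
  [/\ fir_mx Q, fir_mx (Q *m Cz *m Mi), fir_mx (1%:M + G *m Q)
    & fir_mx (Cz *m slp_xx Q)].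
Proof.
have yxE Q : Cz *m slp_xx Q = Cz *m Mi + G *m Q *m Cz *m Mi.
  by rewrite mulmxDr !mulmxA.
split=> [[Pyx [Pyy [Pux [Q [[Fyx Fyy Fux FQ] e1 e2 U ->]]]]]|
         [Q [/(youla_mixed1 (zIsub_unit A))[e1 e2 U ->]]]].
  have [yQ yyE uxE yxE'] := mixed1_youla (zIsub_unit A) e1 e2 U.
  exists Q; split=> //.
  by split; [|rewrite -uxE|rewrite -yyE|rewrite yxE -yxE']; apply: FIR_fir.
rewrite yxE => -[FQ Fux Fyy Fyx].
exists (Cz *m Mi + G *m Q *m Cz *m Mi), (1%:M + G *m Q), (Q *m Cz *m Mi), Q.
by split=> //; split; apply: fir_FIR.
Qed.

Lemma C_M2P K : C_M2 A B C T K <-> exists Q, youla G Q K /\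
  [/\ fir_mx Q, fir_mx (Mi *m Bz *m Q), fir_mx (1%:M + Q *m G)
    & fir_mx (slp_xx Q *m Bz)].
Proof.
have xuE Q : slp_xx Q *m Bz = Mi *m Bz + Mi *m Bz *m Q *m G.
  by rewrite mulmxDl !mulmxA.
split=> [[Pxy [Pxu [Q [Puu [[Fxy FQ Fxu Fuu] e1 e2 U ->]]]]]|
         [Q [/(youla_mixed2 (zIsub_unit A))[e1 e2 U ->]]]].
  have [yQ uuE xyE xuE'] := mixed2_youla (zIsub_unit A) e1 e2 U.
  exists Q; split=> //.
  by split; [|rewrite -xyE|rewrite -uuE|rewrite xuE -xuE']; apply: FIR_fir.
rewrite xuE => -[FQ Fxy Fuu Fxu].
exists (Mi *m Bz *m Q), (Mi *m Bz + Mi *m Bz *m Q *m G), Q, (1%:M + Q *m G).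
by split=> //; split; apply: fir_FIR.
Qed.

Lemma C_IOPP K : C_IOP A B C T K <-> exists Q, youla G Q K /\
  [/\ fir_mx Q, fir_mx (1%:M + G *m Q), fir_mx (1%:M + Q *m G)
    & fir_mx (Cz *m slp_xx Q *m Bz)].
Proof.
have yuE Q : Cz *m slp_xx Q *m Bz = G + G *m Q *m G.
  by rewrite mulmxDr mulmxDl !mulmxA.
split=> [[Pyy [Pyu [Q [Puu [[Fyy FQ Fyu Fuu] e1 e2 U ->]]]]]|
         [Q [/youla_iop[e1 e2 U ->]]]].
  have [yQ yyE uuE yuE'] := iop_youla e1 e2 U.
  exists Q; split=> //.
  by split; [|rewrite -yyE|rewrite -uuE|rewrite yuE -yuE']; apply: FIR_fir.
rewrite yuE => -[FQ Fyy Fuu Fyu].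
exists (1%:M + G *m Q), (G + G *m Q *m G), Q, (1%:M + Q *m G).
by split=> //; split; apply: fir_FIR.
Qed.

Lemma fir_1D k (H : 'M[ratfun R]_k) : fir_mx H -> fir_mx (1%:M + H).
Proof. by move=> FH; apply: (mxallD lin) => //; apply: fir1. Qed.

Lemma fir_1DB k (H : 'M[ratfun R]_k) : fir_mx (1%:M + H) -> fir_mx H.
Proof.
move=> FH; rewrite -[H](addKr 1%:M) addrC; apply: (mxallB lin) => //.
exact: fir1.
Qed.

Lemma C_SLP_M1 : C_SLP A B C T `<=` C_M1 A B C T.
Proof.
move=> K /C_SLPP[Q [yQ [FQ Fux Fxy Fxx]]]; apply/C_M1P; exists Q.
split=> //; split=> //; last exact: mxall_cstl.
by apply: fir_1D; rewrite -!mulmxA; apply: mxall_cstl; rewrite ?mulmxA.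
Qed.

Lemma C_SLP_M2 : C_SLP A B C T `<=` C_M2 A B C T.
Proof.
move=> K /C_SLPP[Q [yQ [FQ Fux Fxy Fxx]]]; apply/C_M2P; exists Q.
split=> //; split=> //; last exact: mxall_cstr.
by apply: fir_1D; rewrite !mulmxA; apply: mxall_cstr.
Qed.

Lemma C_M1_IOP : C_M1 A B C T `<=` C_IOP A B C T.
Proof.
move=> K /C_M1P[Q [yQ [FQ Fux Fyy Fyx]]]; apply/C_IOPP; exists Q.
split=> //; split=> //; last exact: mxall_cstr.
by apply: fir_1D; rewrite !mulmxA; apply: mxall_cstr.
Qed.

Lemma C_M2_IOP : C_M2 A B C T `<=` C_IOP A B C T.
Proof.
move=> K /C_M2P[Q [yQ [FQ Fxy Fuu Fxu]]]; apply/C_IOPP; exists Q.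
split=> //; split=> //; last by rewrite -mulmxA; apply: mxall_cstl.
by apply: fir_1D; rewrite -!mulmxA; apply: mxall_cstl; rewrite ?mulmxA.
Qed.

Lemma strictly_proper_Mi_l k (H : 'M[ratfun R]_(n, k)) :
  fir_mx H -> mxall (@strictly_proper R) (Mi *m H).
Proof.
move=> FH i j; rewrite mxE; apply: lin_closed_sum => [|l].
  exact: strictly_proper_lin_closed.
by apply: strictly_properM (strictly_proper_resolvent A i l) _; case: (FH l j).
Qed.

Lemma strictly_proper_Mi_r k (H : 'M[ratfun R]_(k, n)) :
  fir_mx H -> mxall (@strictly_proper R) (H *m Mi).
Proof.
move=> FH i j; rewrite mxE; apply: lin_closed_sum => [|l].
  exact: strictly_proper_lin_closed.
by rewrite mulrC; apply: strictly_properM (strictly_proper_resolvent A l j) _;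
  case: (FH i l).
Qed.

(** For [Y = Q C M^-1] both [Y M = Q C] and [Y B = Q G] are FIR, so controllability applies; dually
    [M^-1 B Q] is handled by observability. The block [X] takes both arguments in turn. *)
Lemma C_IOP_SLP : controllable A B -> observable A C ->
  C_IOP A B C T `<=` C_SLP A B C T.
Proof.
move=> ctr obs K /C_IOPP[Q [yQ [FQ /fir_1DB FGQ /fir_1DB FQG Fyu]]].
have sl := @strictly_proper_lin_closed R.
have MU := zIsub_unit A.
have Fux : fir_mx (Q *m Cz *m Mi).
  apply: (controllable_mxall lin sl (@fir_zM R T) ctr).
  - by apply: strictly_proper_Mi_r; apply: mxall_cstr.
  - by rewrite (mulmxKV MU); apply: mxall_cstr.
  - by rewrite -!mulmxA (mulmxA Cz).
have Fxy : fir_mx (Mi *m Bz *m Q).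
  apply: (observable_mxall lin sl (@fir_zM R T) obs).
  - by rewrite -mulmxA; apply: strictly_proper_Mi_l; apply: mxall_cstl.
  - by rewrite -mulmxA (mulKVmx MU); apply: mxall_cstl.
  - by rewrite !mulmxA.
apply/C_SLPP; exists Q; split; [exact: yQ|split; try assumption].
have xxM := mul_slp_xx Bz Cz MU Q; have Mxx := slp_xx_mul Bz Cz MU Q.
have xxE := solve_left MU xxM.
have sxx : mxall (@strictly_proper R) (slp_xx Q).
  by rewrite xxE; apply: strictly_proper_Mi_l; apply: fir_1D; apply: mxall_cstl.
(* Controllability reduces [X] to [X M = I + M^-1 B Q C] and [X B]. *)
apply: (controllable_mxall lin sl (@fir_zM R T) ctr) => //.
  by rewrite Mxx; apply: fir_1D; apply: mxall_cstr.
(* Observability reduces [X B] to [M X B = B (I + Q G)] and [C X B]. *)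
apply: (observable_mxall lin sl (@fir_zM R T) obs).
- exact: mxall_cstr.
- rewrite mulmxA xxM mulmxDl mul1mx -!mulmxA.
  rewrite -[X in X + _]mulmx1 -mulmxDr; apply: (mxall_cstl lin).
  by apply: fir_1D; rewrite (mulmxA Cz).
- by rewrite mulmxA.
Qed.

(** Gives access to [realization_choice], which speaks of proper [K] only. As [G] is strictly
    proper, [I + G Q] is the identity at infinity and has a proper inverse. *)
Lemma C_IOP_proper K : C_IOP A B C T K -> Defs.proper K.
Proof.
move=> /C_IOPP[Q [[U KQ] [FQ FGQ _ _]]].
have {KQ}-> : K = Q *m invmx (1%:M + G *m Q) by rewrite -{1}KQ mulmxK.
have pP : mxall (@proper_ratfun R) (invmx (1%:M + G *m Q)).
  apply: proper_invmx; rewrite addrAC subrr add0r -!mulmxA.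
  apply: (mxall_cstl (strictly_proper_lin_closed R)).
  by apply: strictly_proper_Mi_l; apply: mxall_cstl.
move=> i j; rewrite mxE; apply: big_ind => [||k _].
- by rewrite -(rmorph0 (@ratC R)); apply: proper_ratC.
- exact: proper_ratfunD.
by apply: proper_ratfunM (pP _ _); case: (FQ i k).
Qed.

End FIRParameterizations.

(** * Regularity at a point and internal stability *)

Lemma char_poly_tr (S : comNzRingType) n (A : 'M[S]_n) :
  char_poly A^T = char_poly A.
Proof.
rewrite /char_poly -[RHS]det_tr; congr (\det _).
by rewrite /char_poly_mx linearB /= tr_scalar_mx map_trmx.
Qed.

(** The localization of [R[X]] at the polynomials not vanishing at [l]. Any representative will do,
    so sums and products call for no reduction to lowest terms. *)
Definition regular_at (R : realType) (l : R[i]) (f : ratfun R) :=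
  exists a b : {poly R},
    ~~ root (map_poly (real_complex R) b) l /\ f = tofrac a / tofrac b.

Section Regular.
Variables (R : realType) (l : R[i]).
Local Notation reg := (@regular_at R l).

Lemma root_map_neq0 (b : {poly R}) :
  ~~ root (map_poly (real_complex R) b) l -> b != 0.
Proof. by apply: contraNneq => ->; rewrite rmorph0 root0. Qed.

Lemma regular_tofrac (a : {poly R}) : reg (tofrac a).
Proof.
by exists a, 1; rewrite rmorph1 root1 tofrac1 divr1.
Qed.

Lemma regularD f g : reg f -> reg g -> reg (f + g).
Proof.
move=> [a [b [lb ->]]] [c [d [ld ->]]].
exists (a * d + c * b), (b * d).
by rewrite rmorphM rootM negb_or lb ld frac_add ?root_map_neq0.
Qed.

Lemma regularM f g : reg f -> reg g -> reg (f * g).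
Proof.
move=> [a [b [lb ->]]] [c [d [ld ->]]].
exists (a * c), (b * d).
by rewrite rmorphM rootM negb_or lb ld frac_mul.
Qed.

Lemma regular_lin_closed : lin_closed reg.
Proof.
split=> [|f g|c f]; last 2 first.
- exact: regularD.
- by apply: regularM; apply: regular_tofrac.
by rewrite -tofrac0; apply: regular_tofrac.
Qed.

Lemma mxall_regularM m n p (H : 'M[ratfun R]_(m, n)) (K : 'M[ratfun R]_(n, p)) :
  mxall reg H -> mxall reg K -> mxall reg (H *m K).
Proof.
move=> rH rK i j; rewrite mxE; apply: lin_closed_sum => [|k].
  exact: regular_lin_closed.
exact: regularM (rH i k) (rK k j).
Qed.

Lemma mxall_regular_cst m n (M : 'M[R]_(m, n)) : mxall reg (cstmx M).
Proof. by move=> i j; rewrite cstmxE; apply: regular_tofrac. Qed.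

Lemma regular_det n (H : 'M[ratfun R]_n) : mxall reg H -> reg (\det H).
Proof.
move=> rH; apply: big_ind => [||s _].
- by rewrite -tofrac0; apply: regular_tofrac.
- exact: regularD.
apply: regularM.
  by rewrite -(rmorph_sign (@ratC R)); apply: regular_tofrac.
apply: big_ind => [||i _]; last exact: rH.
- by rewrite -tofrac1; apply: regular_tofrac.
- exact: regularM.
Qed.

Lemma regular_fir T (f : ratfun R) : l != 0 -> fir T f -> reg f.
Proof.
move=> l0 [_ [q fq]]; exists q, 'X^T; split.
  by rewrite map_polyXn rootE hornerXn expf_neq0.
by rewrite tofracXn -fq mulfK ?expf_neq0 ?zvar_neq0.
Qed.

(** Cramer's rule: the resolvent is the adjugate divided by the characteristic polynomial. *)
Lemma regular_resolvent n (A : 'M[R]_n) :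
  ~~ root (map_poly (real_complex R) (char_poly A)) l ->
  mxall reg (invmx (zIsub A)).
Proof.
move=> lA i j; rewrite /invmx zIsub_unit det_zIsub zIsubE -map_mx_adj !mxE.
by exists (\adj (char_poly_mx A) i j), (char_poly A); split; rewrite // mulrC mxE.
Qed.

(** The determinant of the resolvent is the inverse of [char_poly A]; a root at [l] would force
    every denominator of it to vanish there. *)
Lemma resolvent_regular n (A : 'M[R]_n) :
  mxall reg (invmx (zIsub A)) ->
  ~~ root (map_poly (real_complex R) (char_poly A)) l.
Proof.
move=> /regular_det [a [b [lb dE]]].
have b0 := root_map_neq0 lb.
apply: contra lb => rA.
have ab : tofrac (char_poly A) * tofrac a = tofrac b.
  have bF : tofrac b != 0 by rewrite tofrac_eq0.
  have := det_mulmx (zIsub A) (invmx (zIsub A)).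
  rewrite (mulmxV (zIsub_unit A)) det1 dE det_zIsub mulrA => e.
  by rewrite -[LHS](divfK bF) -e mul1r.
have -> : b = char_poly A * a.
  by apply/eqP; rewrite -tofrac_eq tofracM ab.
by rewrite rmorphM rootM rA.
Qed.

(* The Popov-Belevitch-Hautus condition that the mode [l] is controllable,
   phrased over R(z) so that complex eigenvectors are never needed. *)
Definition mode_controllable n m (A : 'M[R]_n) (B : 'M[R]_(n, m)) :=
  forall k (Y : 'M[ratfun R]_(k, n)),
  mxall reg (Y *m zIsub A) -> mxall reg (Y *m cstmx B) -> mxall reg Y.

Definition mode_observable n p (A : 'M[R]_n) (C : 'M[R]_(p, n)) :=
  mode_controllable A^T C^T.

Lemma mode_observableP n p (A : 'M[R]_n) (C : 'M[R]_(p, n)) :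
  mode_observable A C -> forall k (X : 'M[ratfun R]_(n, k)),
  mxall reg (zIsub A *m X) -> mxall reg (cstmx C *m X) -> mxall reg X.
Proof.
move=> obs k X rMX rCX; apply: mxall_tr; apply: obs.
  by rewrite -tr_zIsub -trmx_mul; apply: tr_mxall.
by rewrite -tr_cstmx -trmx_mul; apply: tr_mxall.
Qed.

(** Apply controllability to [Y = M^-1], where [Y M = I], then observability to [X = M^-1 B], where
    [M X = B] and [C X] is the transfer matrix. *)
Lemma mode_minimal_regular n m p (A : 'M[R]_n) (B : 'M[R]_(n, m))
    (C : 'M[R]_(p, n)) :
  mode_controllable A B -> mode_observable A C ->
  mxall reg (cstmx C *m invmx (zIsub A) *m cstmx B) ->
  mxall reg (invmx (zIsub A)).
Proof.
move=> ctr /mode_observableP obs rH.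
apply: ctr.
  by rewrite (mulVmx (zIsub_unit A)) -cstmx1; apply: mxall_regular_cst.
apply: obs; last by rewrite mulmxA.
by rewrite (mulKVmx (zIsub_unit A)); apply: mxall_regular_cst.
Qed.

Lemma zIsub_feedback n m (A : 'M[R]_n) (B : 'M[R]_(n, m)) (N : 'M[R]_(m, n)) :
  zIsub (A + B *m N) = zIsub A - cstmx B *m cstmx N.
Proof. by rewrite /zIsub cstmxD cstmxM opprD addrA. Qed.

(** Feedback changes [Y M] only by [(Y B) N], which is regular whenever [Y B] is. *)
Lemma mode_controllable_feedback n m (A : 'M[R]_n) (B : 'M[R]_(n, m)) N :
  mode_controllable A B -> mode_controllable (A + B *m N) B.
Proof.
move=> ctr k Y; rewrite zIsub_feedback mulmxBr mulmxA => rYM rYB.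
apply: ctr => //; rewrite -[_ *m zIsub A](subrK (Y *m cstmx B *m cstmx N)).
apply: (mxallD regular_lin_closed) => //.
exact: (mxall_cstr regular_lin_closed).
Qed.

Lemma mode_observable_injection n p (A : 'M[R]_n) (C : 'M[R]_(p, n)) N :
  mode_observable A C -> mode_observable (A + N *m C) C.
Proof.
rewrite /mode_observable linearD /= trmx_mul.
exact: mode_controllable_feedback.
Qed.

Lemma zIsub_block_diag n1 n2 (A1 : 'M[R]_n1) (A2 : 'M[R]_n2) :
  zIsub (block_mx A1 0 0 A2) = block_mx (zIsub A1) 0 0 (zIsub A2).
Proof.
by rewrite /zIsub cstmx_block !cstmx0 scalar_mx_block opp_block_mx add_block_mx
  !subr0.
Qed.

Lemma mxall_row_mx m n1 n2 (H1 : 'M[ratfun R]_(m, n1))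
    (H2 : 'M[ratfun R]_(m, n2)) :
  mxall reg (row_mx H1 H2) <-> mxall reg H1 /\ mxall reg H2.
Proof.
split=> [rH|[rH1 rH2] i j].
  split=> i j; first by have := rH i (lshift n2 j); rewrite row_mxEl.
  by have := rH i (rshift n1 j); rewrite row_mxEr.
by rewrite mxE; case: (fintype.split j) => k; [apply: rH1|apply: rH2].
Qed.

Lemma mxall_col_mx m1 m2 n (H1 : 'M[ratfun R]_(m1, n))
    (H2 : 'M[ratfun R]_(m2, n)) :
  mxall reg H1 -> mxall reg H2 -> mxall reg (col_mx H1 H2).
Proof.
move=> rH1 rH2 i j.
by rewrite mxE; case: (fintype.split i) => k; [apply: rH1|apply: rH2].
Qed.

Lemma mode_controllable_block n1 n2 m1 m2 (A1 : 'M[R]_n1) (A2 : 'M[R]_n2)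
    (B1 : 'M[R]_(n1, m1)) (B2 : 'M[R]_(n2, m2)) :
  mode_controllable A1 B1 -> mode_controllable A2 B2 ->
  mode_controllable (block_mx A1 0 0 A2) (block_mx B1 0 0 B2).
Proof.
move=> ctr1 ctr2 k Y; rewrite -[Y]hsubmxK zIsub_block_diag cstmx_block !cstmx0.
rewrite !mul_row_block !mulmx0 !addr0 !add0r.
move=> /mxall_row_mx[? ?] /mxall_row_mx[? ?].
by apply/mxall_row_mx; split; [apply: ctr1|apply: ctr2].
Qed.

Lemma mode_observable_block n1 n2 p1 p2 (A1 : 'M[R]_n1) (A2 : 'M[R]_n2)
    (C1 : 'M[R]_(p1, n1)) (C2 : 'M[R]_(p2, n2)) :
  mode_observable A1 C1 -> mode_observable A2 C2 ->
  mode_observable (block_mx A1 0 0 A2) (block_mx C1 0 0 C2).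
Proof.
rewrite /mode_observable !tr_block_mx !trmx0.
exact: mode_controllable_block.
Qed.

Lemma controllable_mode n m (A : 'M[R]_n) (B : 'M[R]_(n, m)) :
  controllable A B -> mode_controllable A B.
Proof.
move=> ctr k Y; have rz f : True -> reg f -> reg (zvar R * f).
  by move=> _; apply: regularM; apply: regular_tofrac.
(* [S] is trivial here, since multiplication by [z] always preserves regularity. *)
exact: (controllable_mxall regular_lin_closed (S := fun=> True) _ rz ctr).
Qed.

Lemma observable_mode n p (A : 'M[R]_n) (C : 'M[R]_(p, n)) :
  observable A C -> mode_observable A C.
Proof. by move=> /observable_tr; apply: controllable_mode. Qed.

(** Factor [Y = (Y M') M'^-1] with [M' = zI - (A + B N)]: the first factor is regular by hypothesis,
    the second because [l] is no eigenvalue of the Schur stable matrix. *)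
Lemma stabilizable_mode n m (A : 'M[R]_n) (B : 'M[R]_(n, m)) :
  ~~ (`|l| < 1) -> stabilizable A B -> mode_controllable A B.
Proof.
move=> l1 [N sN] k Y rYM rYB.
rewrite -(mulmxK (zIsub_unit (A + B *m N)) Y).
apply: mxall_regularM.
  rewrite zIsub_feedback mulmxBr mulmxA.
  apply: (mxallB regular_lin_closed) => //.
  exact: (mxall_cstr regular_lin_closed).
apply: regular_resolvent; apply: contra l1.
by rewrite map_char_poly -eigenvalue_root_char => /sN.
Qed.

Lemma detectable_mode n p (A : 'M[R]_n) (C : 'M[R]_(p, n)) :
  ~~ (`|l| < 1) -> detectable A C -> mode_observable A C.
Proof.
move=> l1 [L sL]; apply: stabilizable_mode => //; exists L^T => mu.
rewrite -trmx_mul -linearD /= eigenvalue_root_char -map_char_poly char_poly_tr.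
by rewrite map_char_poly -eigenvalue_root_char => /sL.
Qed.

End Regular.

(** * Powers of Schur stable matrices *)

Lemma cvg0_linear_recursion (R : realType) (r : R) (a b : nat -> R) :
  0 <= r < 1 -> (forall t, 0 <= a t) -> (forall t, a t.+1 <= r * a t + b t) ->
  b t @[t --> \oo] --> (0 : R) -> a t @[t --> \oo] --> (0 : R).
Proof.
move=> /andP[r0 r1] a0 ab b0.
apply/cvgrPdist_lt => e e0.
have r1' : 0 < 1 - r by rewrite subr_gt0.
(* With forcing at most [d = e / 2 * (1 - r)], the map [t |-> r t + d] fixes [e / 2], the constant
   term of the bound [aN]. *)
have d0 : 0 < e / 2 * (1 - r) by rewrite mulr_gt0// divr_gt0.
move/cvgrPdist_lt: b0 => /(_ _ d0)[N _ bN].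
have aN k : a (N + k)%N <= r ^+ k * a N + e / 2.
  elim: k => [|k IH]; first by rewrite addn0 expr0 mul1r lerDl ltW// divr_gt0.
  rewrite addnS (le_trans (ab _))//.
  have /(le_lt_trans (ler_norm _))/ltW bk : `|b (N + k)%N| < e / 2 * (1 - r).
    by have := bN (N + k)%N (leq_addr _ _); rewrite sub0r normrN.
  rewrite (le_trans (lerD (ler_wpM2l r0 IH) bk))//.
  by rewrite le_eqVlt exprS; apply/orP; left; apply/eqP; ring.
have rk : r ^+ k * a N @[k --> \oo] --> (0 : R).
  rewrite -(mul0r (a N)); apply: cvgMl.
  by apply: cvg_expr; rewrite ger0_norm.
have e2 : 0 < e / 2 by rewrite divr_gt0.
move/cvgrPdist_lt: rk => /(_ _ e2)[K _ rK].
exists (N + K)%N => // t /= NKt.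
rewrite sub0r normrN ger0_norm//.
have Nt : (N <= t)%N := leq_trans (leq_addr _ _) NKt.
rewrite -(subnKC Nt) (le_lt_trans (aN _))// [ltRHS]splitr ltrD2r.
have := rK (t - N)%N; rewrite /= leq_subRL// => /(_ NKt).
by rewrite sub0r normrN; apply: le_lt_trans (ler_norm _).
Qed.

Local Notation normc := Normc.normc.

(** The norm of [R[i]] takes values in [R[i]]; limits are stated with the real-valued [normc]. *)
Lemma normcrE (R : realType) (z : R[i]) : `|z| = (normc z)%:C%C.
Proof. by case: z. Qed.

Lemma normc_triangle (R : realType) (z w : R[i]) :
  normc (z + w) <= normc z + normc w.
Proof. by rewrite -lecR rmorphD /= -!normcrE ler_normD. Qed.

(** Induction on the roots: [w = (A - z) v] obeys the same recursion and is annihilated by one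
    factor fewer, while [v] satisfies the scalar recursion [v' = z v + w] with [|z| < 1] and [w]
    tending to 0. *)
Lemma cvg0_annihilated (R : realType) n (A : 'M[R[i]]_n.+1) (s : seq R[i])
    (v : nat -> 'cV[R[i]]_n.+1) :
  (forall z, z \in s -> `|z| < 1) -> (forall t, v t.+1 = A *m v t) ->
  horner_mx A (\prod_(z <- s) ('X - z%:P)) *m v 0%N = 0 ->
  forall i, normc (v t i 0) @[t --> \oo] --> (0 : R).
Proof.
elim: s v => [|z s IH] v s1 vS.
  rewrite big_nil rmorph1 mul1mx => v0 i.
  have -> : (fun t => normc (v t i 0)) = (fun=> 0 : R).
    apply/funext => t; suff -> : v t = 0 by rewrite mxE Normc.normc0.
    by elim: t => // t IH; rewrite vS IH mulmx0.
  exact: cvg_cst.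
rewrite big_cons mulrC rmorphM rmorphB /= horner_mx_X horner_mx_C -mulmxA => pv i.
pose w t := (A - z%:M) *m v t.
have wS t : w t.+1 = A *m w t.
  rewrite /w vS !mulmxA; congr (_ *m _).
  by rewrite mulmxBl mulmxBr mul_mx_scalar mul_scalar_mx.
have w0 := IH w (fun y ys => s1 y (mem_behead (s := z :: s) ys)) wS pv i.
apply: (cvg0_linear_recursion (r := normc z)) w0.
- have := s1 z (mem_head _ _); rewrite normcrE -[1]/(1%:C)%C ltcR => ->.
  by rewrite andbT -lecR -normcrE normr_ge0.
- by move=> t; rewrite -lecR -normcrE normr_ge0.
move=> t; have -> : v t.+1 i 0 = z * v t i 0 + w t i 0.
  have -> : v t.+1 = z *: v t + w t.
    by rewrite vS /w mulmxBl mul_scalar_mx addrC subrK.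
  by rewrite mxE [X in X + _]mxE.
by rewrite (le_trans (normc_triangle _ _))// Normc.normcM.
Qed.

Lemma schur_stable_cvg0 (R : realType) n (A : 'M[R]_n) (x : nat -> 'cV[R]_n) :
  schur_stable A -> (forall t, x t.+1 = A *m x t) ->
  forall i, x t i 0 @[t --> \oo] --> (0 : R).
Proof.
(* Dimension zero is treated apart, [cvg0_annihilated] being stated in positive dimension; there
   Cayley-Hamilton supplies the annihilating product. *)
case: n A x => [|n] A x sA xS i; first by case: i.
pose Ac := map_mx (real_complex R) A.
pose v t := map_mx (real_complex R) (x t).
have [s sE] := closed_field_poly_normal (char_poly Ac).
rewrite (eqP (char_poly_monic Ac)) scale1r in sE.
have v0 : normc (v t i 0) @[t --> \oo] --> (0 : R).
  apply: (@cvg0_annihilated R n Ac s).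
  - move=> z zs; apply: sA; rewrite eigenvalue_root_char sE.
    by rewrite root_prod_XsubC.
  - by move=> t; rewrite /v xS map_mxM.
  - by rewrite -sE Cayley_Hamilton mul0mx.
apply/norm_cvg0P; apply: cvg_trans v0; apply: near_eq_cvg.
apply: nearW => t; rewrite mxE.
by apply: (@complexI R); rewrite -normcrE normc_def /= expr0n addr0 sqrtr_sqr.
Qed.

Lemma cvg_mx0 (R : realType) m n (x : nat -> 'M[R]_(m, n)) :
  (forall i j, x t i j @[t --> \oo] --> (0 : R)) ->
  x t @[t --> \oo] --> (0 : 'M[R]_(m, n)).
Proof.
move=> x0; apply/cvg_ballP => e e0.
have xe : \forall t \near \oo, forall i j, ball (0 : R) e (x t i j).
  apply: filter_forall => i; apply: filter_forall => j.
  by move/cvg_ballP: (x0 i j); apply.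
apply: filterS xe => t xe; split=> // i j; rewrite mxE; exact: xe.
Qed.

(** * Closed loop *)

(** With [G], [H] the open- and closed-loop transfer matrices, [H (I - J G) = G]. Hence [I + J H] is
    a left inverse of [I - J G] and equals the right inverse [W]. *)
Lemma feedback_transfer (F : comUnitRingType) n m p (M : 'M[F]_n)
    (B : 'M[F]_(n, m)) (C : 'M[F]_(p, n)) (J : 'M[F]_(m, p)) (W : 'M[F]_m) :
  M \in unitmx -> M - B *m J *m C \in unitmx ->
  (1%:M - J *m (C *m invmx M *m B)) *m W = 1%:M ->
  J *m (C *m invmx (M - B *m J *m C) *m B) = W - 1%:M.
Proof.
move=> MU NU; set H := C *m invmx (_ - _) *m _; set G := C *m invmx M *m B => W1.
have BG : B *m (1%:M - J *m G) = (M - B *m J *m C) *m (invmx M *m B).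
  by rewrite mulmxBl mulKVmx// mulmxBr mulmx1 /G !mulmxA.
have HG : H *m (1%:M - J *m G) = G.
  by rewrite /H -mulmxA BG mulmxA mulmxKV// mulmxA.
have : (1%:M + J *m H) *m (1%:M - J *m G) = 1%:M.
  by rewrite mulmxDl mul1mx -mulmxA HG subrK.
move=> /(congr1 (mulmx^~ W)); rewrite -mulmxA W1 mulmx1 mul1mx => <-.
by rewrite addrAC subrr add0r.
Qed.

Lemma transfer_block_diag (F : comUnitRingType) n1 n2 m1 m2 p1 p2
    (M1 : 'M[F]_n1) (M2 : 'M[F]_n2) (B1 : 'M[F]_(n1, m1)) (B2 : 'M[F]_(n2, m2))
    (C1 : 'M[F]_(p1, n1)) (C2 : 'M[F]_(p2, n2)) :
  block_mx M1 0 0 M2 \in unitmx ->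
  block_mx C1 0 0 C2 *m invmx (block_mx M1 0 0 M2) *m block_mx B1 0 0 B2
  = block_mx (C1 *m invmx M1 *m B1) 0 0 (C2 *m invmx M2 *m B2).
Proof.
move=> U; rewrite invmx_block_diag// !mulmx_block.
by rewrite !(mul0mx, mulmx0, addr0, add0r).
Qed.

(** [K] is meant as the strictly proper part of the controller and [D] as its static gain, which
    belongs to the interconnection; this is why the blocks are those of IOP shifted by multiples of
    [D]. *)
Lemma loop_inverse (F : comUnitRingType) m p (G : 'M[F]_(p, m))
    (K D Q : 'M[F]_(m, p)) : youla G Q (K + D) ->
  (1%:M - block_mx D 1%:M 1%:M 0 *m block_mx G 0 0 K) *m
  block_mx (1%:M + Q *m G) (Q - (1%:M + Q *m G) *m D)
           (G + G *m Q *m G) (1%:M + G *m Q - (G + G *m Q *m G) *m D) = 1%:M.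
Proof.
move=> yQ; have [_ KQ] := yQ; have PQ := youla_right_mul yQ.
set Puu := 1%:M + Q *m G; set Pyy := 1%:M + G *m Q in KQ *.
have -> : G + G *m Q *m G = G *m Puu by rewrite mulmxDr mulmx1 mulmxA.
have QE : Q = (K + D) + (K + D) *m G *m Q by rewrite -{1}PQ subrK.
(* That is, [(I - (K + D) G) (I + Q G) = I]. *)
have KP : (1%:M - D *m G) *m Puu - K *m (G *m Puu) = 1%:M.
  rewrite mulmxBl mul1mx -addrA -opprD -!mulmxA -mulmxDl [D + K]addrC.
  rewrite [_ *m (G *m Puu)]mulmxA /Puu mulmxDr mulmx1 mulmxA {1}QE mulmxDl.
  by rewrite addrK.
have KD : (1%:M - D *m G) *m Q - K *m Pyy = D.
  have -> : K *m Pyy = Q - D *m Pyy by rewrite -[X in X - _]KQ mulmxDl addrK.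
  rewrite mulmxBl mul1mx opprB addrC addrA subrK /Pyy mulmxDr mulmx1 mulmxA.
  by rewrite addrK.
rewrite mulmx_block !mulmx0 !mul0mx !mul1mx !addr0 !add0r scalar_mx_block.
rewrite opp_block_mx add_block_mx mulmx_block oppr0 !add0r addr0 !mulNmx !mul1mx.
rewrite addNr KP; congr block_mx.
  rewrite !mulmxBr opprB addrACA [- _ + _]addrC -addrACA -[K *m _ - _]opprB.
  by rewrite KD !mulmxA -mulmxBl -!mulmxA KP mul1mx subrr.
rewrite mulmxBr opprB mulmxA addrC addrA subrK.
by rewrite addrK.
Qed.

Section ClosedLoop.
Variables (R : realType) (n m p nk : nat).
Variables (A : 'M[R]_n) (B : 'M[R]_(n, m)) (C : 'M[R]_(p, n)).
Variables (Ak : 'M[R]_nk) (Bk : 'M[R]_(nk, p)) (Ck : 'M[R]_(m, nk)).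
Variable Dk : 'M[R]_(m, p).

(** Plant and controller side by side, with inputs [(u, y)] and outputs [(y, Ck xi)]; the static
    gain [interconnection] closes the loop. The closed loop is thus at once a state feedback and an
    output injection. *)
Definition open_A := block_mx A 0 0 Ak.
Definition open_B := block_mx B 0 0 Bk.
Definition open_C := block_mx C 0 0 Ck.
Definition interconnection : 'M[R]_(m + p, p + m) := block_mx Dk 1%:M 1%:M 0.
Definition closed_A := open_A + open_B *m (interconnection *m open_C).

Lemma closed_loop_regular (l : R[i]) Q :
  mode_controllable l A B -> mode_observable l A C ->
  mode_controllable l Ak Bk -> mode_observable l Ak Ck ->
  let G := cstmx C *m invmx (zIsub A) *m cstmx B in
  youla G Q (transfer Ak Bk Ck Dk) ->
  mxall (regular_at l) Q -> mxall (regular_at l) (1%:M + G *m Q) ->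
  mxall (regular_at l) (1%:M + Q *m G) ->
  mxall (regular_at l) (G + G *m Q *m G) ->
  mxall (regular_at l) (invmx (zIsub closed_A)).
Proof.
move=> cA oA ck ok G yQ rQ rP rP' rG.
have rl := regular_lin_closed l.
apply: (@mode_minimal_regular _ _ _ _ _ closed_A open_B open_C).
- exact/mode_controllable_feedback/mode_controllable_block.
- by rewrite /closed_A mulmxA;
    apply/mode_observable_injection/mode_observable_block.
have NE : zIsub closed_A
    = zIsub open_A - cstmx open_B *m cstmx interconnection *m cstmx open_C.
  by rewrite zIsub_feedback cstmxM mulmxA.
have NU := zIsub_unit closed_A; rewrite NE in NU.
have GE : cstmx open_C *m invmx (zIsub open_A) *m cstmx open_B
    = block_mx G 0 0 (cstmx Ck *m invmx (zIsub Ak) *m cstmx Bk).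
  have U := zIsub_unit open_A.
  rewrite zIsub_block_diag in U *.
  by rewrite !cstmx_block !cstmx0 transfer_block_diag.
have JE : cstmx interconnection = block_mx (cstmx Dk) 1%:M 1%:M 0.
  by rewrite cstmx_block !cstmx1 cstmx0.
have W1 := loop_inverse yQ; rewrite -GE -JE in W1.
have HE := feedback_transfer (zIsub_unit open_A) NU W1.
rewrite -NE in HE; set H := cstmx open_C *m invmx _ *m cstmx open_B in HE *.
(* [J'] is the constant inverse of [interconnection]; it recovers [H] from its product with the
   interconnection. *)
pose J' : 'M[R]_(p + m, m + p) := block_mx 0 1%:M 1%:M (- Dk).
have J'J : J' *m interconnection = 1%:M.
  rewrite mulmx_block !(mul0mx, mulmx0, mul1mx, mulmx1) !(add0r, addr0) subrr.
  by rewrite -scalar_mx_block.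
have -> : H = cstmx J' *m (cstmx interconnection *m H).
  by rewrite mulmxA -cstmxM J'J cstmx1 mul1mx.
rewrite HE; apply: (mxall_cstl rl); apply: (mxallB rl).
  (* The blocks of the loop inverse are the IOP blocks, corrected by right multiples by [Dk]. *)
  apply: mxall_col_mx; apply/mxall_row_mx; split=> //; apply: (mxallB rl) => //.
    exact: (mxall_cstr rl).
  exact: (mxall_cstr rl).
by rewrite -cstmx1; apply: mxall_regular_cst.
Qed.

Lemma closed_A_step (x : 'cV[R]_n) (xi : 'cV[R]_nk) :
  closed_A *m col_mx x xi
  = col_mx (A *m x + B *m (Ck *m xi + Dk *m (C *m x)))
           (Ak *m xi + Bk *m (C *m x)).
Proof.
rewrite mulmxDl -!mulmxA !mul_block_col !(mul0mx, mul1mx, add0r, addr0).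
by rewrite add_col_mx [Dk *m _ + _]addrC.
Qed.

End ClosedLoop.

(** At each [l] with [|l| >= 1] the resolvent of [closed_A] is regular, so [l] is no eigenvalue;
    Schur stability then gives convergence of the joint state. *)
Lemma C_IOP_internally_stabilizes (R : realType) n m p T (A : 'M[R]_n)
    (B : 'M[R]_(n, m)) (C : 'M[R]_(p, n)) (r : realization R m p) K :
  (forall l : R[i], ~~ (`|l| < 1) ->
     [/\ mode_controllable l A B, mode_observable l A C,
         mode_controllable l (Ak r) (Bk r) & mode_observable l (Ak r) (Ck r)]) ->
  C_IOP A B C T K -> realizes r K -> internally_stabilizes A B C r.
Proof.
move=> modes /C_IOPP[Q [yQ [FQ FP FP' FG]]] rK.
rewrite -rK in yQ.
have sA : schur_stable (closed_A A B C (Ak r) (Bk r) (Ck r) (Dk r)).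
  move=> l; rewrite eigenvalue_root_char -map_char_poly.
  apply: contraTT => l1; have [cA oA ck ok] := modes l l1.
  (* FIR blocks may have a pole at [0], which lies inside the unit disc. *)
  have l0 : l != 0 by apply: contraNneq l1 => ->; rewrite normr0 ltr01.
  have reg k j (H : 'M[ratfun R]_(k, j)) :
      mxall (fir T) H -> mxall (regular_at l) H.
    by move=> FH a b; apply: regular_fir (FH a b).
  apply: resolvent_regular.
  apply: (closed_loop_regular cA oA ck ok yQ); try exact: reg.
  by apply: reg; move: FG; rewrite mulmxDr mulmxDl !mulmxA; apply.
move=> x y xi u loop.
pose s t := col_mx (x t) (xi t).
have sS t : s t.+1 = closed_A A B C (Ak r) (Bk r) (Ck r) (Dk r) *m s t.
  rewrite closed_A_step /s; have [-> + -> ->] := loop t; rewrite !addr0 => ->.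
  by [].
have s0 := schur_stable_cvg0 sA sS.
split; apply: cvg_mx0 => i j; rewrite ord1.
  have := s0 (lshift _ i); apply: cvg_trans; apply: near_eq_cvg.
  by apply: nearW => t; rewrite /s col_mxEu.
have := s0 (rshift _ i); apply: cvg_trans; apply: near_eq_cvg.
by apply: nearW => t; rewrite /s col_mxEd.
Qed.

Theorem corollary5 (R : realType) (n m p T : nat)
    (A : 'M[R]_n) (B : 'M[R]_(n, m)) (C : 'M[R]_(p, n))
    (rho : 'M[ratfun R]_(m, p) -> realization R m p)
    (hrho : realization_choice rho) :
  (stabilizable A B -> detectable A C ->
   (forall K, C_all A B C T K ->
      stabilizable (Ak (rho K)) (Bk (rho K)) /\
      detectable (Ak (rho K)) (Ck (rho K))) ->
   [/\ C_SLP A B C T `<=` C_M1 A B C T,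
       C_M1 A B C T `<=` C_IOP A B C T &
       C_IOP A B C T `<=` C_stab A B C rho] /\
   [/\ C_SLP A B C T `<=` C_M2 A B C T,
       C_M2 A B C T `<=` C_IOP A B C T &
       C_IOP A B C T `<=` C_stab A B C rho]) /\
  (controllable A B -> observable A C ->
   (forall K, C_all A B C T K ->
      controllable (Ak (rho K)) (Bk (rho K)) /\
      observable (Ak (rho K)) (Ck (rho K))) ->
   [/\ C_SLP A B C T = C_M1 A B C T,
       C_M1 A B C T = C_M2 A B C T,
       C_M2 A B C T = C_IOP A B C T &
       C_IOP A B C T `<=` C_stab A B C rho]).
Proof.
(* Both hypotheses on the realizations enter stability only through the mode conditions outside the
   open unit disc. *)
have stab K : C_IOP A B C T K ->
    (forall l : R[i], ~~ (`|l| < 1) ->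
      [/\ mode_controllable l A B, mode_observable l A C,
          mode_controllable l (Ak (rho K)) (Bk (rho K))
        & mode_observable l (Ak (rho K)) (Ck (rho K))]) ->
    C_stab A B C rho K.
  move=> iopK modes; have rK := hrho _ (C_IOP_proper iopK).
  by split=> //; apply: C_IOP_internally_stabilizes iopK rK.
split=> [stabAB detAC ctl|ctrAB obsAC ctl].
  have iop_stab : C_IOP A B C T `<=` C_stab A B C rho.
    move=> K iopK; apply: stab => // l l1; have [sk dk] := ctl K (or_intror iopK).
    by split; (exact: stabilizable_mode || exact: detectable_mode).
  split; split=> //; [exact: C_SLP_M1|exact: C_M1_IOP|exact: C_SLP_M2|].
  exact: C_M2_IOP.
(* This inclusion closes both chains into cycles, turning the inclusions into equalities. *)
have iop_slp := C_IOP_SLP (T := T) ctrAB obsAC.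
split.
- apply/seteqP; split; first exact: C_SLP_M1.
  exact: subset_trans (@C_M1_IOP _ _ _ _ _ _ _ _) iop_slp.
- apply/seteqP; split.
    apply: subset_trans (@C_M1_IOP _ _ _ _ _ _ _ _) _.
    exact: subset_trans iop_slp (@C_SLP_M2 _ _ _ _ _ _ _ _).
  apply: subset_trans (@C_M2_IOP _ _ _ _ _ _ _ _) _.
  exact: subset_trans iop_slp (@C_SLP_M1 _ _ _ _ _ _ _ _).
- apply/seteqP; split; first exact: C_M2_IOP.
  exact: subset_trans iop_slp (@C_SLP_M2 _ _ _ _ _ _ _ _).
move=> K iopK; apply: stab => // l l1; have [ck ok] := ctl K (or_intror iopK).
by split; (exact: controllable_mode || exact: observable_mode).
Qed.
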